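(* Let $E$ be a $\sigma$-MV-effect algebra, let $x,y$ be bounded observables on $E$, and let $\{B_x(t): t\in\mathbb R\}$ and $\{B_y(t): t\in\mathbb R\}$ be their spectral resolutions. Define $$B_{x+y}(t):=\bigvee_{r\in\mathbb Q}\big(B_x(r)\wedge B_y(t-r)\big),\quad t\in\mathbb R,$$ and, with the roles of $x$ and $y$ exchanged, $B_{y+x}(t):=\bigvee_{r\in\mathbb Q}(B_y(r)\wedge B_x(t-r))$. Then: (a) $B_{x+y}(t)\le B_{x+y}(s)$ whenever $t<s$; (b) $\bigwedge_{t\in\mathbb R}B_{x+y}(t)=0$ and $\bigvee_{t\in\mathbb R}B_{x+y}(t)=1$; (c) $\bigvee_{t<s}B_{x+y}(t)=B_{x+y}(s)$ for each $s\in\mathbb R$; (d) there is a unique bounded observable $z$ on $E$ such that $B_{x+y}(t)=B_z(t)$ for each $t\in\mathbb R$; (e) $B_{x+y}(t)=B_{y+x}(t)$ for each $t\in\mathbb R$.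
   Context: An effect algebra is a partial algebra $(E;+,0,1)$ with a partial binary operation $+$ such that for all $a,b,c\in E$: (i) $a+b$ is defined iff $b+a$ is, and then $a+b=b+a$; (ii) $a+b$ and $(a+b)+c$ are defined iff $b+c$ and $a+(b+c)$ are, and then $(a+b)+c=a+(b+c)$; (iii) for each $a$ there is a unique $a'\in E$ with $a+a'=1$; (iv) if $a+1$ is defined then $a=0$. It is partially ordered by $a\le b$ iff $a+c=b$ for some $c\in E$. An MV-effect algebra is an effect algebra that is a lattice under $\le$ and in which $a\wedge b=0$ implies that $a+b$ is defined. A $\sigma$-MV-effect algebra is an MV-effect algebra in which all countable joins and meets exist. An observable on $E$ is a mapping $x:\mathcal B(\mathbb R)\to E$ ($\mathcal B(\mathbb R)$ the Borel $\sigma$-algebra of $\mathbb R$) such that (i) $x(\mathbb R)=1$; (ii) if $A\cap B=\emptyset$ then $x(A)+x(B)$ is defined and $x(A\cup B)=x(A)+x(B)$; (iii) if $A_i\subseteq A_{i+1}$ for each $i$ and $\bigcup_iA_i=A$, then $x(A)=\bigvee_ix(A_i)$. It is bounded if $x([\alpha,\beta])=1$ for some interval $[\alpha,\beta]$. The spectral resolution of $x$ is $\{B_x(t):t\in\mathbb R\}$, where $B_x(t):=x((-\infty,t))$. *)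

(* Defs.v *)
From HB Require Import structures.
From mathcomp Require Import all_boot all_order all_algebra.
From mathcomp Require Import all_classical all_reals all_analysis.

Set Implicit Arguments.
Unset Strict Implicit.
Unset Printing Implicit Defensive.

Import Order.TTheory GRing.Theory Num.Theory.
Local Open Scope classical_set_scope.
Local Open Scope ring_scope.

(* The partial sum is option-valued, [None] meaning "undefined".  The strong
   equality of [eaddA] says that both sides are defined simultaneously and are
   then equal.  The order is carried by the structure but completely determined
   by the sum through [le_eadd]; that this relation is a partial order is not
   an extra assumption, see the factory [isEffectAlgebra] below. *)
HB.mixin Record POrder_isEffectAlgebra (d : Order.disp_t) E
    of Order.POrder d E := {
  eadd : E -> E -> option E;
  ezero : E;
  eone : E;
  eaddC : forall a b : E, eadd a b = eadd b a;
  eaddA : forall a b c : E,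
    obind (fun u => eadd u c) (eadd a b) =
    obind (fun v => eadd a v) (eadd b c);
  eorthoP : forall a : E, exists! a' : E, eadd a a' = Some eone;
  eadd1_eq0 : forall a : E, isSome (eadd a eone) -> a = ezero;
  le_eadd : forall a b : E, (a <= b)%O <-> exists c : E, eadd a c = Some b
}.

#[short(type="effectAlgebraType")]
HB.structure Definition EffectAlgebra (d : Order.disp_t) :=
  { E of POrder_isEffectAlgebra d E & Order.POrder d E }.

Arguments ezero {d s}.
Arguments eone {d s}.

HB.factory Record isEffectAlgebra (d : Order.disp_t) E of Choice E := {
  eadd : E -> E -> option E;
  ezero : E;
  eone : E;
  eaddC : forall a b : E, eadd a b = eadd b a;
  eaddA : forall a b c : E,
    obind (fun u => eadd u c) (eadd a b) =
    obind (fun v => eadd a v) (eadd b c);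
  eorthoP : forall a : E, exists! a' : E, eadd a a' = Some eone;
  eadd1_eq0 : forall a : E, isSome (eadd a eone) -> a = ezero
}.

HB.builders Context d E of isEffectAlgebra d E.

Let ele (a b : E) : bool := `[< exists c, eadd a c = Some b >].

Let eadd01 : eadd ezero eone = Some eone.
Proof.
have [u [hu _]] := eorthoP eone.
have u0 : u = ezero by apply: eadd1_eq0; rewrite eaddC hu.
by rewrite eaddC -u0.
Qed.

Let eadd0 a : eadd a ezero = Some a.
Proof.
have [a' [ha' _]] := eorthoP a; have [w [_ uniq_w]] := eorthoP a'.
have := eaddA a' a ezero; rewrite eaddC ha' /= eaddC eadd01.
case ha0: (eadd a ezero) => [v|] //= hv.
by rewrite -(uniq_w v (esym hv)) -(uniq_w a) // eaddC.
Qed.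

Let eadd_eq0 a b : eadd a b = Some ezero -> a = ezero /\ b = ezero.
Proof.
move=> hab.
have b0 : b = ezero.
  apply: eadd1_eq0; have := eaddA a b eone; rewrite hab /= eadd01.
  by case: (eadd b eone).
by move: hab; rewrite b0 eadd0 => -[->].
Qed.

Let eadd_id a u : eadd a u = Some a -> u = ezero.
Proof.
move=> hau; have [a' [ha' _]] := eorthoP a.
apply: eadd1_eq0; have := eaddA a' a u.
by rewrite eaddC in ha'; rewrite hau /= ha' /= eaddC => ->.
Qed.

Let ele_refl : reflexive ele.
Proof. by move=> a; apply/asboolP; exists ezero; exact: eadd0. Qed.

Let ele_trans : transitive ele.
Proof.
move=> b a c /asboolP[u hu] /asboolP[v hv]; apply/asboolP.
have := eaddA a u v; rewrite hu /= hv.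
by case: (eadd u v) => [w|] //= hw; exists w.
Qed.

Let ele_anti : antisymmetric ele.
Proof.
move=> a b /andP[/asboolP[u hu] /asboolP[v hv]].
have := eaddA a u v; rewrite hu /= hv.
case huv: (eadd u v) => [w|] //= /esym/eadd_id w0.
have [u0 _] := eadd_eq0 (etrans huv (congr1 Some w0)).
by move: hu; rewrite u0 eadd0 => -[].
Qed.

HB.instance Definition _ :=
  Order.Le_isPOrder.Build d E ele_refl ele_anti ele_trans.

Let le_eadd (a b : E) : (a <= b)%O <-> exists c : E, eadd a c = Some b.
Proof. by split=> /asboolP. Qed.

HB.instance Definition _ := POrder_isEffectAlgebra.Build d E
  eaddC eaddA eorthoP eadd1_eq0 le_eadd.

HB.end.

HB.mixin Record EffectAlgebra_isMV (d : Order.disp_t) E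
    of EffectAlgebra d E & Order.Lattice d E := {
  eadd_disjoint : forall a b : E,
    Order.meet a b = ezero -> isSome (eadd a b)
}.

#[short(type="mvEffectAlgebraType")]
HB.structure Definition MVEffectAlgebra (d : Order.disp_t) :=
  { E of EffectAlgebra_isMV d E & EffectAlgebra d E & Order.Lattice d E }.

HB.mixin Record MVEffectAlgebra_isSigma (d : Order.disp_t) E
    of MVEffectAlgebra d E := {
  countable_has_join : forall A : set E, countable A -> supremums A !=set0;
  countable_has_meet : forall A : set E, countable A -> infimums A !=set0
}.

#[short(type="sigmaMVEffectAlgebraType")]
HB.structure Definition SigmaMVEffectAlgebra (d : Order.disp_t) :=
  { E of MVEffectAlgebra_isSigma d E & MVEffectAlgebra d E }.

Record borel (R : realType) := Borel {
  borel_set :> set (measurableTypeR R);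
  borel_measurable : measurable borel_set
}.

Definition borel_itv (R : realType) (i : interval R) : borel R :=
  Borel (measurable_itv i).

Section Observables.
Variables (R : realType) (d : Order.disp_t).

Definition observable (E : effectAlgebraType d) (x : borel R -> E) : Prop :=
  [/\ forall A : borel R, A = setT :> set R -> x A = eone,
      forall A B C : borel R, A `&` B = set0 -> C = A `|` B :> set R ->
        eadd (x A) (x B) = Some (x C)
    & forall (A : nat -> borel R) (C : borel R),
        (forall i, A i `<=` A i.+1) -> C = \bigcup_i A i :> set R ->
        supremums (range (fun i => x (A i))) (x C)].

Definition bounded_observable (E : effectAlgebraType d) (x : borel R -> E)
    : Prop :=
  observable x /\ exists a b : R, x (borel_itv `[a, b]) = eone.

Definition spectral_resolution (E : effectAlgebraType d) (x : borel R -> E)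
    (t : R) : E := x (borel_itv `]-oo, t[).

(* [supremum] is a genuine join here, as the family is countable; its default
   value [ezero] is never used. *)
Definition spectral_sum (E : sigmaMVEffectAlgebraType d)
    (x y : borel R -> E) (t : R) : E :=
  supremum ezero (range (fun r : rat =>
    Order.meet (spectral_resolution x (ratr r))
               (spectral_resolution y (t - ratr r)))).

End Observables.

(* Main.v *)
Require Import Defs.
From HB Require Import structures.
From mathcomp Require Import all_boot all_order all_algebra.
From mathcomp Require Import all_classical all_reals all_analysis.
From mathcomp Require Import measurable_realfun.
From mathcomp Require Import lra zify.

(** The five clauses are of very unequal depth.  Monotonicity, the bounds, left
continuity and the symmetry of the sum only use that the join over the
rationals is countable and that a meet distributes over every join that exists
([is_sup_meet]): boundedness forces the sum to be constant near both ends, and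
left continuity lets a rational [r] and the possibly irrational [t - r] trade
places ([minconv_le_sym]).  Uniqueness of the observable is an induction on
Borel sets ([borel_induction]).

The substance is the existence of an observable with a prescribed bounded
left-continuous resolution [B] ([observable_of_resolution]).  Approximating
from outside by open sets does not work, because an MV-effect algebra need not
be weakly sigma-distributive: among the Borel subsets of the unit interval
modulo meager ones, every relatively open set around the rationals has value
one, and the rationals have value zero.  Instead the algebra is tested against
its states, that is, the additive maps [w] to the reals with [w eone = 1].  A
state preserving the relevant joins turns [B] into the distribution function
of a probability measure [mu] on the line ([left_cdf_measure]).  A Borel set
[A] should be sent to the element [a] with [w a = mu A] for all such [w].  No
single state can be asked to preserve all countable joins, so [a] is only
required to work for the states that preserve some countable family of joins
fixed in advance ([determined]); every step of the generation of Borel sets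
adds countably many joins to the family.  That such an [a] is unique, and
monotone in [A], means that if [a] is not below [b], then some state preserving
a given countable family of joins gives [a] a larger value than [b]
([separating_state]).

This separation is a Rasiowa-Sikorski (Baire category) argument.  Sharp
elements, those disjoint from their complement, play the part of clopen sets of
maximal ideals, and every element has a least sharp element above it, its
carrier.  A decreasing sequence of nonzero sharp elements is built: the first
one lies where [a] exceeds [b], and each later one makes the defect of one of
the prescribed joins at most [1/k] ([vanishing_at]).  Any state with
value one on the whole sequence is as required.  Such a state exists
([state_exists]): it is the limit along an ultrafilter of approximate states,
each additive on a finite set up to a small error.  An approximate state
counts how often a small element [g] fits into each of the given elements, as
in the construction of Haar measure; this count makes sense after passing to a
smaller nonzero sharp element, where finitely many comparisons are decided
([division_at], [approx_state]). *)

Set Implicit Arguments.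
Unset Strict Implicit.
Unset Printing Implicit Defensive.

Import Order.TTheory GRing.Theory Num.Theory.
Import numFieldNormedType.Exports.
Local Open Scope classical_set_scope.
Local Open Scope ring_scope.

(** * Effect algebras as partial commutative monoids *)

(** Adjoining an absorbing value, for sums that are undefined, turns the
partial addition into a commutative monoid. A hypothesis of the form [x + y =
c%:S] then says at once that the sum exists and what it is, and iterated sums
are the multiples [*+] of the monoid. *)
Definition totalization (d : Order.disp_t) (E : effectAlgebraType d) : Type :=
  option E.

Definition defined (d : Order.disp_t) (E : effectAlgebraType d) (a : E)
  : totalization E := Some a.

Local Notation "a %:S" := (defined a) (at level 1, format "a %:S").
Local Notation "a ⊓ b" := (Order.meet a b) (at level 40, left associativity).
Local Notation "a ⊔ b" := (Order.join a b) (at level 40, left associativity).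

Section Totalization.
Variables (d : Order.disp_t) (E : effectAlgebraType d).
Implicit Types (a b c : E).

Lemma eadd01 : eadd (ezero : E) eone = Some eone.
Proof.
have [u [hu _]] := eorthoP (eone : E).
have u0 : u = ezero by apply: eadd1_eq0; rewrite eaddC hu.
by rewrite eaddC -u0.
Qed.

Lemma eadd0 a : eadd a ezero = Some a.
Proof.
have [a' [ha' _]] := eorthoP a; have [w [_ uniq_w]] := eorthoP a'.
have := eaddA a' a ezero; rewrite eaddC ha' /= eaddC eadd01.
case ha0: (eadd a ezero) => [v|] //= hv.
by rewrite -(uniq_w v (esym hv)) -(uniq_w a) // eaddC.
Qed.

HB.instance Definition _ := Choice.copy (totalization E) (option E).

Definition addt (x y : totalization E) : totalization E :=
  obind (fun a => obind (eadd a) y) x.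

Lemma addtC : commutative addt.
Proof. by case=> [a|] [b|] //=; rewrite eaddC. Qed.

Lemma addtA : associative addt.
Proof.
case=> [a|] [b|] [c|] //=; first exact: (esym (eaddA a b c)).
- by case: (eadd a b).
Qed.

Lemma add0t : left_id (defined ezero) addt.
Proof. by case=> [a|] //=; rewrite eaddC eadd0. Qed.

HB.instance Definition _ :=
  GRing.isNmodule.Build (totalization E) addtA addtC add0t.

Lemma orthot_ex a : exists b, a%:S + b%:S = (eone : E)%:S.
Proof. by have [b [hb _]] := eorthoP a; exists b. Qed.

Definition eortho a : E := sval (cid (orthot_ex a)).

Definition esub b a : E := xget ezero [set c | a%:S + c%:S = b%:S].
End Totalization.

Local Notation "a ^⊥" := (eortho a) (at level 1, format "a ^⊥").
Local Notation "b ⊖ a" := (esub b a) (at level 50, left associativity).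

Section EffectAlgebraTheory.
Variables (d : Order.disp_t) (E : effectAlgebraType d).
Implicit Types (a b c : E) (x y z : totalization E).

Lemma addt_comm x y z : x + y = z -> y + x = z.
Proof. by rewrite addrC. Qed.

Lemma zerotE : (ezero : E)%:S = 0. Proof. by []. Qed.

Lemma defined_inj : injective (@defined d E). Proof. by move=> a b []. Qed.

(** The undefined value is absorbing, so a sum with a defined value has
defined terms, and so has each of its partial sums. *)
Lemma addt_defined x y c : x + y = c%:S ->
  exists a b, x = a%:S /\ y = b%:S.
Proof. by case: x y => [a|] [b|] // _; exists a, b. Qed.

Lemma addt_ortho a : a%:S + a^⊥%:S = (eone : E)%:S.
Proof. exact: svalP (cid (orthot_ex a)). Qed.

Lemma eortho_uniq a x : a%:S + x = (eone : E)%:S -> x = a^⊥%:S.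
Proof.
case: x => [b|] // hb; have [w [_ u]] := eorthoP a.
by congr Some; rewrite -(u b) // -(u a^⊥) //; exact: addt_ortho.
Qed.

Lemma eorthoK : involutive (@eortho d E).
Proof.
by move=> a; apply/esym/defined_inj/eortho_uniq; rewrite addrC addt_ortho.
Qed.

(** Adding the complement of [c] makes [y] and [z] both complements of the
same element, and complements are unique. *)
Lemma addtI x y z c : x + y = c%:S -> x + z = c%:S -> y = z.
Proof.
move=> hy hz; have [a [b [ea eb]]] := addt_defined hy; subst x y.
have h1 : b%:S + (a%:S + c^⊥%:S) = (eone : E)%:S.
  by rewrite addrA [b%:S + _]addrC hy addt_ortho.
have [_ [w [_ ew]]] := addt_defined h1; rewrite ew addrC in h1.
rewrite (eortho_uniq h1); apply/esym/eortho_uniq.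
by rewrite -ew addrAC hz addt_ortho.
Qed.

Lemma le_addtP a b : (a <= b)%O <-> exists x, a%:S + x = b%:S.
Proof.
split=> [/le_eadd[c hc]|[[c|] // hc]]; first by exists c%:S.
by apply/le_eadd; exists c.
Qed.

Lemma addt_le a x c : a%:S + x = c%:S -> (a <= c)%O.
Proof. by move=> h; apply/le_addtP; exists x. Qed.

Lemma addt_ler x b c : x + b%:S = c%:S -> (b <= c)%O.
Proof. by rewrite addrC; exact: addt_le. Qed.

Lemma ezero_le a : (ezero <= a)%O.
Proof. by apply: (@addt_le _ a%:S); rewrite zerotE add0r. Qed.

Lemma le_eone a : (a <= eone)%O.
Proof. exact: addt_le (addt_ortho a). Qed.

Lemma le_ezero a : (a <= ezero)%O -> a = ezero.
Proof. by move=> a0; apply/le_anti; rewrite a0 ezero_le. Qed.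

Lemma addt_id a x : a%:S + x = a%:S -> x = 0.
Proof. by move=> h; apply: (addtI h); rewrite addr0. Qed.

Lemma eortho0 : (ezero : E)^⊥ = eone.
Proof. by apply/esym/defined_inj/eortho_uniq; rewrite zerotE add0r. Qed.

Lemma eortho1 : (eone : E)^⊥ = ezero.
Proof. by rewrite -eortho0 eorthoK. Qed.

Lemma esubK a b : (a <= b)%O -> a%:S + (b ⊖ a)%:S = b%:S.
Proof.
move=> /le_eadd[c hc]; rewrite /esub; case: xgetP => [z _ //|].
by move=> /(_ c).
Qed.

Lemma esub_uniq a x b : a%:S + x = b%:S -> x = (b ⊖ a)%:S.
Proof. by move=> h; apply: (addtI h); apply: esubK; exact: addt_le h. Qed.

Lemma esub_le a b : (a <= b)%O -> (b ⊖ a <= b)%O.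
Proof. by move=> /esubK; exact: addt_ler. Qed.

Lemma esubKl a b : (a <= b)%O -> b ⊖ (b ⊖ a) = a.
Proof.
by move=> ab; apply/esym/defined_inj/esub_uniq; rewrite addrC esubK.
Qed.

Lemma esub_eq0 a b : (a <= b)%O -> b ⊖ a = ezero -> a = b.
Proof. by move=> /esubK + h; rewrite h addr0; exact: defined_inj. Qed.

(** Summability becomes an inequality, to which order arguments apply. *)
Lemma addt_defP a b : (exists c, a%:S + b%:S = c%:S) <-> (a <= b^⊥)%O.
Proof.
split=> [[c h]|/esubK h].
  apply: (@addt_le _ c^⊥%:S); apply: eortho_uniq.
  by rewrite addrCA addrA h addt_ortho.
have : a%:S + b%:S + (b^⊥ ⊖ a)%:S = (eone : E)%:S.
  by rewrite addrAC h addrC addt_ortho.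
by move=> /addt_defined[c [_ [-> _]]]; exists c.
Qed.

Lemma le_orthoC a b : (a <= b)%O -> (b^⊥ <= a^⊥)%O.
Proof.
move=> ab; apply/addt_defP.
have /addt_defP[c hc] : (a <= b^⊥^⊥)%O by rewrite eorthoK.
by exists c; rewrite addrC.
Qed.

Lemma le_ortho2 a b : (a^⊥ <= b^⊥)%O -> (b <= a)%O.
Proof. by move/le_orthoC; rewrite !eorthoK. Qed.

Lemma le_ortho_sym a b : (a <= b^⊥)%O -> (b <= a^⊥)%O.
Proof. by move/le_orthoC; rewrite eorthoK. Qed.

Lemma addt_mono a1 a b1 b c : (a1 <= a)%O -> (b1 <= b)%O ->
  a%:S + b%:S = c%:S -> exists2 c1, a1%:S + b1%:S = c1%:S & (c1 <= c)%O.
Proof.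
move=> /esubK ha /esubK hb; rewrite -ha -hb addrACA => h.
have [c1 [_ [h1 _]]] := addt_defined h; exists c1 => //.
by rewrite h1 in h; exact: addt_le h.
Qed.

Lemma addt_le2 a1 a b1 b c1 c : (a1 <= a)%O -> (b1 <= b)%O ->
  a%:S + b%:S = c%:S -> a1%:S + b1%:S = c1%:S -> (c1 <= c)%O.
Proof.
by move=> ha hb h; have [c2 -> ?] := addt_mono ha hb h; move=> /defined_inj <-.
Qed.

Lemma addt_leI a b1 b2 c1 c2 : a%:S + b1%:S = c1%:S -> a%:S + b2%:S = c2%:S ->
  (c1 <= c2)%O -> (b1 <= b2)%O.
Proof.
move=> h1 h2 /esubK; rewrite -h1 -addrA => h.
by have := addtI h h2; exact: addt_le.
Qed.

Lemma esub_monor a b1 b2 : (a <= b1)%O -> (b1 <= b2)%O ->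
  (b1 ⊖ a <= b2 ⊖ a)%O.
Proof.
move=> h1 h2; apply: (addt_leI (esubK h1) _ h2); apply: esubK.
exact: le_trans h1 h2.
Qed.

Lemma esub_monol a1 a2 b : (a1 <= a2)%O -> (a2 <= b)%O ->
  (b ⊖ a2 <= b ⊖ a1)%O.
Proof.
move=> h1 h2; have := esubK h2; rewrite -(esubK h1) -addrA => h.
by have := addtI h (esubK (le_trans h1 h2)); exact: addt_ler.
Qed.

End EffectAlgebraTheory.

(** * Joins of families *)

(** The defining equivalence of the join, for a family instead of a set: it
rewrites goals in either direction without choosing bounds. *)
Definition is_sup (d : Order.disp_t) (E : porderType d) (I : Type) (u : I -> E)
  (s : E) : Prop := forall w, (s <= w)%O <-> forall i, (u i <= w)%O.

Section Suprema.
Variables (d : Order.disp_t) (E : porderType d) (I : Type).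
Implicit Types (u : I -> E) (s w : E).

Lemma is_supP u s : supremums (range u) s <-> is_sup u s.
Proof.
split=> [[ub lb] w|h].
  split=> [sw i|h]; first by apply: le_trans sw; apply: ub; exists i.
  by apply: lb => _ [i _ <-]; exact: h.
split; last by move=> w hw; apply/(h w) => i; apply: hw; exists i.
by move=> _ [i _ <-]; exact: (proj1 (h s)).
Qed.

Lemma is_sup_ub u s i : is_sup u s -> (u i <= s)%O.
Proof. by move=> h; exact: (proj1 (h s)). Qed.

Lemma is_sup_least u s w : is_sup u s -> (forall i, (u i <= w)%O) -> (s <= w)%O.
Proof. by move=> h; exact: (proj2 (h w)). Qed.

Lemma is_sup_uniq u s1 s2 : is_sup u s1 -> is_sup u s2 -> s1 = s2.
Proof.
move=> h1 h2; apply/le_anti/andP.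
split; first by apply: (is_sup_least h1) => i; exact: is_sup_ub.
by apply: (is_sup_least h2) => i; exact: is_sup_ub.
Qed.

End Suprema.

(** * Lattice structure and truncated sums in MV-effect algebras *)

Section MVTheory.
Variables (d : Order.disp_t) (E : mvEffectAlgebraType d).
Implicit Types (a b c e p q u v w : E).

(** Adding [c] is an order isomorphism from the elements below [c^⊥] onto
those above [c]. *)
Lemma meet_addt a b c u v : a%:S + c%:S = u%:S -> b%:S + c%:S = v%:S ->
  (a ⊓ b)%:S + c%:S = (u ⊓ v)%:S.
Proof.
move=> hu hv.
have cw : (c <= u ⊓ v)%O by rewrite lexI (addt_ler hu) (addt_ler hv).
have [s hs su] := addt_mono (leIl a b) (lexx c) hu.
have [s' hs' sv] := addt_mono (leIr b a) (lexx c) hv.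
have es : s' = s by move: hs'; rewrite hs => /defined_inj.
rewrite hs; congr Some; apply/le_anti; rewrite lexI su -es sv /= es.
have hw := esubK cw; apply: (addt_le2 _ _ (addt_comm hs) hw) => //.
by rewrite lexI (addt_leI hw (addt_comm hu) (leIl _ _))
  (addt_leI hw (addt_comm hv) (leIr _ _)).
Qed.

Lemma join_addt a b c u v : a%:S + c%:S = u%:S -> b%:S + c%:S = v%:S ->
  (a ⊔ b)%:S + c%:S = (u ⊔ v)%:S.
Proof.
move=> hu hv.
have cw : (c <= u ⊔ v)%O by apply: le_trans (addt_ler hu) _; exact: leUl.
have hw := esubK cw.
have hab : (a ⊔ b <= (u ⊔ v) ⊖ c)%O.
  by rewrite leUx (addt_leI (addt_comm hu) hw (leUl _ _))
    (addt_leI (addt_comm hv) hw (leUr _ _)).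
have [s hs sw] := addt_mono hab (lexx c) (addt_comm hw).
rewrite hs; congr Some; apply/le_anti; rewrite sw /= leUx.
by rewrite (addt_le2 (leUl a b) (lexx c) hs hu)
  (addt_le2 (leUr b a) (lexx c) hs hv).
Qed.

(** Adding the common part [a ⊓ b] to the meet of the two excesses gives back
[a ⊓ b]. *)
Lemma esubI_disj a b : (a ⊖ (a ⊓ b)) ⊓ (b ⊖ (a ⊓ b)) = ezero.
Proof.
have ha := esubK (leIl a b); have hb := esubK (leIr b a).
have := meet_addt (addt_comm ha) (addt_comm hb); rewrite addrC => /addt_id h.
exact: defined_inj.
Qed.

(** Cut [b] into the part [p] that completes [a] to the join and a remainder
[q]. Since [p + a] is above [b = p + q], cancelling [p] gives [q] below [a];
so [q] is below [a ⊓ b] and vanishes. *)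
Lemma addt_disj a b : a ⊓ b = ezero -> a%:S + b%:S = (a ⊔ b)%:S.
Proof.
move=> ab0; have := eadd_disjoint _ _ ab0.
case hs : (eadd a b) => [s|] // _; rewrite -[eadd a b]/(a%:S + b%:S) in hs.
have us : (a ⊔ b <= s)%O by rewrite leUx (addt_le hs) (addt_ler hs).
have hp := esubK (leUl a b : (a <= a ⊔ b)%O).
have pb := addt_leI hp hs us.
have hq := esubK pb.
have qa := addt_leI hq (addt_comm hp) (leUr _ _).
have q0 : b ⊖ ((a ⊔ b) ⊖ a) = ezero.
  by apply: le_ezero; rewrite -ab0 lexI qa (addt_ler hq).
by rewrite (esub_eq0 pb q0) in hp.
Qed.

(** The source of everything lattice-theoretic below: the excess of [b] over
[a] is the same whether measured from the meet or up to the join. *)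
Lemma addt_joinE a b : a%:S + (b ⊖ (a ⊓ b))%:S = (a ⊔ b)%:S.
Proof.
have ha := esubK (leIl a b); have hb := esubK (leIr b a).
rewrite -{1}ha -addrA (addt_disj (esubI_disj a b)) addrC.
by apply: join_addt; rewrite addrC.
Qed.

(** Riesz decomposition of [c] into [a ⊓ c] and a rest; the rest completes [a]
to [a ⊔ c], which is below [a + b], so cancelling [a] bounds it by [b]. *)
Lemma riesz_decomposition a b s c : a%:S + b%:S = s%:S -> (c <= s)%O ->
  (c ⊖ (a ⊓ c) <= b)%O.
Proof.
move=> hs cs; apply: (addt_leI (addt_joinE a c) hs).
by rewrite leUx cs (addt_le hs).
Qed.

(** By [addt_joinE], [u i] is [a ⊓ u i] plus an element below the excess of
[s] over [a]. So if [w] bounds all the [a ⊓ u i], then [w], cut down to [a ⊓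
s], plus that excess bounds all the [u i], hence bounds [s]; cancelling the
excess leaves [a ⊓ s] below [w]. *)
Lemma is_sup_meet (I : Type) (u : I -> E) s a : is_sup u s ->
  is_sup (fun i => a ⊓ u i) (a ⊓ s).
Proof.
move=> hs w; split=> [aw i|hw].
  by apply: le_trans aw; apply: leI2 => //; exact: is_sup_ub.
(* [w] is cut down to [a ⊓ s] so that adding the excess [x] is defined. *)
pose w' := w ⊓ (a ⊓ s); pose x := s ⊖ (a ⊓ s).
have hx : (a ⊓ s)%:S + x%:S = s%:S by apply: esubK; exact: leIr.
have [y hy _] : exists2 y, w'%:S + x%:S = y%:S & (y <= s)%O.
  by apply: addt_mono hx; rewrite ?leIr.
have sy : (s <= y)%O.
  apply: (is_sup_least hs) => i.
  have hi := esubK (leIr (u i) a).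
  apply: (addt_le2 _ _ hy hi).
    by rewrite lexI hw leI2 // is_sup_ub.
  apply: (addt_leI (addt_joinE a (u i)) (addt_joinE a s)).
  by rewrite leU2 // is_sup_ub.
by have := addt_leI (addt_comm hx) (addt_comm hy) sy; rewrite lexI => /andP[].
Qed.

Lemma is_sup_addt (I : Type) (u v : I -> E) s c w (i0 : I) : is_sup u s ->
  (forall i, c%:S + (u i)%:S = (v i)%:S) -> c%:S + s%:S = w%:S -> is_sup v w.
Proof.
move=> hs hv hw y; split=> [wy i|vy].
  apply: le_trans wy; apply: (addt_le2 _ _ hw (hv i)) => //.
  exact: is_sup_ub.
have cy : (c <= y)%O by apply: le_trans (vy i0); exact: addt_le (hv i0).
have hy := esubK cy; apply: (addt_le2 _ _ hy hw) => //.
by apply: (is_sup_least hs) => i; exact: addt_leI (hv i) hy (vy i).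
Qed.

Lemma is_sup_ortho (I : Type) (u : I -> E) s w : is_sup u s ->
  (forall i, (w <= (u i)^⊥)%O) -> (w <= s^⊥)%O.
Proof.
move=> hs hw; apply: le_ortho_sym; apply: (is_sup_least hs) => i.
exact: le_ortho_sym.
Qed.

(** Disjoint elements are summable, and [a] is summable with [b^⊥] exactly
when it is below [b]. *)
Lemma disj_le a b : a ⊓ b^⊥ = ezero -> (a <= b)%O.
Proof.
move=> /addt_disj h; rewrite -[b]eorthoK; apply/addt_defP.
by exists (a ⊔ b^⊥).
Qed.

Lemma disj_addt a b c s : a ⊓ b = ezero -> a ⊓ c = ezero ->
  b%:S + c%:S = s%:S -> a ⊓ s = ezero.
Proof.
move=> ab ac hs; have := riesz_decomposition hs (leIr s a).
have -> : b ⊓ (a ⊓ s) = ezero.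
  by apply: le_ezero; rewrite -ab lexI leIl andbT (le_trans (leIr _ _)) ?leIl.
have /esubK := ezero_le (a ⊓ s); rewrite zerotE add0r => /defined_inj -> h.
by apply: le_ezero; rewrite -ac lexI h leIl.
Qed.

Lemma disj_mono a b a' b' : a ⊓ b = ezero -> (a' <= a)%O -> (b' <= b)%O ->
  a' ⊓ b' = ezero.
Proof. by move=> h ha hb; apply: le_ezero; rewrite -h leI2. Qed.

(** Sharp elements form the Boolean part of the algebra; below, they serve as
regions to which elements are restricted by taking meets. *)
Definition sharp e := e ⊓ e^⊥ = ezero.

Lemma sharp_le a e : sharp e -> (a <= e)%O <-> a ⊓ e^⊥ = ezero.
Proof. by move=> he; split=> [ae|/disj_le//]; exact: disj_mono he ae _. Qed.

Lemma sharp_split e a : sharp e -> (a ⊓ e)%:S + (a ⊓ e^⊥)%:S = a%:S.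
Proof.
move=> he; have ha := esubK (leIl a e).
have d0 : (a ⊓ e) ⊓ (a ⊓ e^⊥) = ezero.
  by apply: disj_mono he _ _; exact: leIr.
suff -> : a ⊓ e^⊥ = a ⊖ (a ⊓ e) by [].
apply/le_anti/andP; split; last first.
  rewrite lexI (esub_le (leIl _ _)) meetC.
  by rewrite (riesz_decomposition (addt_ortho e) (le_eone a)).
by apply: (addt_leI (addt_disj d0) ha); rewrite leUx !leIl.
Qed.

(** Restriction to a sharp element commutes with sums. One inequality is the
Riesz decomposition; for the other, the sum of the two restrictions is
disjoint from [e^⊥], hence below [e]. *)
Lemma restr_addt e a b c : sharp e -> a%:S + b%:S = c%:S ->
  (a ⊓ e)%:S + (b ⊓ e)%:S = (c ⊓ e)%:S.
Proof.
move=> he hc.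
have [s hs sc] := addt_mono (leIl a e) (leIl b e) hc.
rewrite hs; congr Some; apply/le_anti; rewrite lexI sc /=; apply/andP; split.
  apply/(sharp_le _ he); rewrite meetC; apply: disj_addt hs.
    by rewrite meetC; apply/sharp_le => //; exact: leIr.
  by rewrite meetC; apply/sharp_le => //; exact: leIr.
have hce : (c ⊓ e <= c)%O by exact: leIl.
have h1 := riesz_decomposition hc hce.
have h2 := esubK (leIr (c ⊓ e) a).
apply: (addt_le2 _ _ hs h2).
  by rewrite leI2 ?leIr.
by rewrite lexI h1 (le_trans (esub_le (leIr _ _)) (leIr _ _)).
Qed.

Lemma restr_muln e a k m : sharp e -> a%:S *+ k = m%:S ->
  (a ⊓ e)%:S *+ k = (m ⊓ e)%:S.
Proof.
move=> he; elim: k m => [|k IH] m.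
  rewrite !mulr0n => h; have -> : m = ezero by apply: defined_inj; rewrite -h.
  by congr Some; apply/esym/le_ezero; exact: leIl.
rewrite !mulrS => h; have [_ [n [_ hn]]] := addt_defined h.
by rewrite (IH n hn); rewrite hn in h; exact: restr_addt.
Qed.

Lemma meet_restr e e1 a : (e1 <= e)%O -> a ⊓ e ⊓ e1 = a ⊓ e1.
Proof. by move=> h; rewrite -meetA (meet_r h). Qed.

(** Comparisons over a region [e] take the form [a ⊓ e <= b]. *)
Lemma le_on_sharp e a b : sharp e -> (a ⊖ (a ⊓ b)) ⊓ e = ezero ->
  (a ⊓ e <= b)%O.
Proof.
move=> he h0; have := restr_addt he (esubK (leIl a b)).
rewrite h0 zerotE addr0 => /defined_inj <-.
by rewrite (le_trans (leIl _ _)) ?leIr.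
Qed.

Lemma esubI_eq0 a b : a ⊖ (a ⊓ b) = ezero -> (a <= b)%O.
Proof.
by move=> h; rewrite -(esub_eq0 (leIl a b) h) leIr.
Qed.

(** The sum of [a] and [b] truncated at [eone]. The two terms of the sum are
always summable, so the default value does not occur. *)
Definition tadd a b : E := odflt ezero (a%:S + (a^⊥ ⊓ b)%:S).

Lemma taddE a b : a%:S + (a^⊥ ⊓ b)%:S = (tadd a b)%:S.
Proof.
rewrite /tadd; have [s ->] // : exists s, a%:S + (a^⊥ ⊓ b)%:S = s%:S.
by apply/addt_defP; apply: le_ortho_sym; exact: leIl.
Qed.

Lemma tadd_ortho a b : (a^⊥ ⊓ b)%:S + ((tadd a b)^⊥)%:S = (a^⊥)%:S.
Proof. by apply: eortho_uniq; rewrite addrA taddE addt_ortho. Qed.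

Lemma tadd_esub a b : (tadd a b)^⊥ = a^⊥ ⊖ (a^⊥ ⊓ b).
Proof. exact/defined_inj/esub_uniq/tadd_ortho. Qed.

(** This expression of the complement makes the truncated sum visibly monotone
in [a], as [tadd_esub] does in [b]. *)
Lemma tadd_orthoE a b : (tadd a b)^⊥ = (a^⊥ ⊔ b) ⊖ b.
Proof.
apply/defined_inj/esub_uniq; rewrite joinC -addt_joinE meetC; congr (_ + _).
by rewrite tadd_esub.
Qed.

Lemma tadd_mono a b a' b' : (a <= a')%O -> (b <= b')%O ->
  (tadd a b <= tadd a' b')%O.
Proof.
move=> ha hb; apply: (@le_trans _ _ (tadd a' b)); apply: le_ortho2.
  rewrite !tadd_orthoE; apply: esub_monor; first exact: leUr.
  by apply: leU2 => //; exact: le_orthoC.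
rewrite !tadd_esub.
by apply: esub_monol; rewrite ?leIl // leI2.
Qed.

(** Where [b] does not fit into the complement of [a], the truncated sum is
already full. *)
Lemma tadd_excess a b : (b ⊖ (a^⊥ ⊓ b)) ⊓ (tadd a b)^⊥ = ezero.
Proof.
have := esubI_disj (a^⊥) b.
by rewrite tadd_esub meetC.
Qed.

Lemma tadd_riesz a b c : (c <= tadd a b)%O -> (c ⊖ (a ⊓ c) <= b)%O.
Proof.
by move=> h; apply: le_trans (riesz_decomposition (taddE a b) h) (leIr _ _).
Qed.

Fixpoint tmul p n : E := if n is m.+1 then tadd (tmul p m) p else ezero.

Lemma tmulS p n :
  (tmul p n)%:S + ((tmul p n)^⊥ ⊓ p)%:S = (tmul p n.+1)%:S.
Proof. exact: taddE. Qed.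

Lemma tmul1 p : tmul p 1 = p.
Proof.
apply: defined_inj; rewrite -tmulS /= zerotE add0r eortho0; congr Some.
by apply: meet_r; exact: le_eone.
Qed.

Lemma tmul_nd p m n : (m <= n)%N -> (tmul p m <= tmul p n)%O.
Proof.
elim: n => [|n IH]; first by rewrite leqn0 => /eqP ->.
rewrite leq_eqVlt => /predU1P[-> //|/IH h].
by apply: le_trans h _; exact: addt_le (tmulS p n).
Qed.

Lemma tmul_mono p q n : (p <= q)%O -> (tmul p n <= tmul q n)%O.
Proof. by move=> pq; elim: n => [//|n IH] /=; exact: tadd_mono. Qed.

Lemma tmul_disj a p n : a ⊓ p = ezero -> a ⊓ tmul p n = ezero.
Proof.
move=> ap; elim: n => [|n IH]; first by apply: le_ezero; exact: leIr.
apply: disj_addt IH _ (tmulS p n).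
by apply: disj_mono ap _ _ => //; exact: leIr.
Qed.

(** A lower bound [c] of the truncated sums of [tmul (v i) k] and [v i]
exceeds [tmul (v i) k] by something below [v j], for all [i] and [j], by
monotonicity. The excess is then zero, and induction on [k] applies. *)
Lemma tmul_inf0 (v : nat -> E) k c :
  (forall i j, (i <= j)%N -> (v j <= v i)%O) ->
  (forall w, (forall i, (w <= v i)%O) -> w = ezero) ->
  (forall i, (c <= tmul (v i) k)%O) -> c = ezero.
Proof.
move=> vd v0; elim: k => [|k IH] in c *; first by move=> /(_ 0%N)/le_ezero.
move=> hc; apply: IH => i; rewrite -(@meet_l _ _ c (tmul (v i) k)) ?leIr //.
apply: esubI_eq0; rewrite meetC; apply: v0 => j.
have h := tadd_riesz (hc (maxn i j)).
apply: le_trans (le_trans h (vd _ _ (leq_maxr i j))).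
by rewrite esub_monol ?leIr // leI2 // tmul_mono // vd // leq_maxl.
Qed.

End MVTheory.

(** * Carriers and sharp elements *)

Section SigmaTheory.
Variables (d : Order.disp_t) (E : sigmaMVEffectAlgebraType d).
Implicit Types (a b c e p q v w : E).

(** The join of a countable family, which always exists; the default value is
reached only when the index type is empty. *)
Definition countable_join (I : countType) (u : I -> E) : E :=
  supremum ezero (range u).

Lemma countable_joinP (I : countType) (i0 : I) (u : I -> E) :
  is_sup u (countable_join u).
Proof.
apply/is_supP; rewrite /countable_join /supremum; case: ifPn => [/eqP h|_].
  by exfalso; rewrite -[False]/(set0 (u i0)) -h; exists i0.
have [|s hs] := countable_has_join (range u).
  exact: (sub_countable (card_image_le _ _)).
by case: xgetP => // /(_ s).
Qed.

(** The region where [p] is not zero, as the join of the truncated multiples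
of [p]. *)
Definition carrier p : E := countable_join (tmul p).

Lemma carrierP p : is_sup (tmul p) (carrier p).
Proof. exact: (countable_joinP 0%N). Qed.

Lemma tmul_le_carrier p n : (tmul p n <= carrier p)%O.
Proof. exact: is_sup_ub (carrierP p). Qed.

Lemma le_carrier p : (p <= carrier p)%O.
Proof. by rewrite -{1}(tmul1 p) tmul_le_carrier. Qed.

Lemma carrier_disj a p : a ⊓ p = ezero -> a ⊓ carrier p = ezero.
Proof.
move=> ap; apply: le_ezero.
apply: (is_sup_least (is_sup_meet a (carrierP p))) => i.
by rewrite tmul_disj.
Qed.

(** The part of [p] outside [s], the carrier, can be added to every truncated
multiple of [p] and keeps it below the next one. So it can be added to [s]
without leaving [s], and vanishes. *)
Lemma carrier_sharp p : sharp (carrier p).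
Proof.
rewrite /sharp meetC; apply: carrier_disj.
set s := carrier p; have [t ht] : exists t, (s^⊥ ⊓ p)%:S + s%:S = t%:S.
  by apply/addt_defP; exact: leIl.
have hv i : exists t, (s^⊥ ⊓ p)%:S + (tmul p i)%:S = t%:S.
  have [t' ? _] := addt_mono (lexx (s^⊥ ⊓ p)) (tmul_le_carrier p i) ht.
  by exists t'.
pose v i := sval (cid (hv i)).
have vP i : (s^⊥ ⊓ p)%:S + (tmul p i)%:S = (v i)%:S.
  exact: svalP (cid (hv i)).
have h := is_sup_addt 0%N (carrierP p) vP ht.
have ts : (t <= s)%O.
  apply: (is_sup_least h) => i; apply: le_trans (tmul_le_carrier p i.+1).
  apply: (addt_le2 _ _ (addt_comm (tmulS p i)) (vP i)) => //.
  by apply: leI2 => //; apply: le_orthoC; exact: tmul_le_carrier.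
have est : t = s.
  by apply/le_anti/andP; split => //; exact: addt_ler ht.
apply: defined_inj; rewrite zerotE; apply: (@addt_id _ _ s).
by rewrite addrC ht est.
Qed.

Lemma carrier_le p e : sharp e -> (p <= e)%O -> (carrier p <= e)%O.
Proof.
move=> he /(sharp_le _ he) h; apply/(sharp_le _ he).
by rewrite meetC; apply: carrier_disj; rewrite meetC.
Qed.

Lemma carrier_neq0 p : p <> ezero -> carrier p <> ezero.
Proof. by move=> + h; apply; apply: le_ezero; rewrite -h le_carrier. Qed.

Lemma meet_carrier_neq0 p e : e <> ezero -> (e <= carrier p)%O ->
  p ⊓ e <> ezero.
Proof.
move=> e0 es h; apply: e0; apply: le_ezero.
by rewrite -(@carrier_disj e p) 1?meetC // meet_r.
Qed.

(** A region, kept nonzero so that some state can still live on it. *)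
Definition locus e := sharp e /\ e <> ezero.

Lemma locus_carrier p : p <> ezero -> locus (carrier p).
Proof. by move=> h; split; [exact: carrier_sharp|exact: carrier_neq0]. Qed.

Lemma le_on_carrier a b : (b ⊓ carrier (a ⊖ (a ⊓ b)) <= a)%O.
Proof.
apply: le_on_sharp; first exact: carrier_sharp.
by apply: carrier_disj; rewrite meetC [b ⊓ a]meetC; exact: esubI_disj.
Qed.

(** The two excesses of [a] and [b] over each other are disjoint, hence so are
their carriers; either the first excess misses [e], or the carrier of its part
in [e] is a region where [b] is below [a]. *)
Lemma compare_at e a b : locus e ->
  (a ⊓ e <= b)%O \/
  exists e1, [/\ locus e1, (e1 <= e)%O & (b ⊓ e1 <= a)%O].
Proof.
move=> [he e0]; set w := a ⊖ (a ⊓ b).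
have [w0|w0] := pselect (w ⊓ e = ezero); first by left; exact: le_on_sharp.
right; exists (carrier (w ⊓ e)); split; first exact: locus_carrier.
  by apply: carrier_le => //; exact: leIr.
apply: le_on_sharp; first exact: carrier_sharp.
apply: carrier_disj.
apply: (@disj_mono _ _ (b ⊖ (b ⊓ a)) w) => //; last exact: leIl.
by rewrite meetC [b ⊓ a]meetC; exact: esubI_disj.
Qed.

(** As long as the truncated multiple is not full anywhere in the region,
nothing has been truncated there ([tadd_excess]), so that the multiple exists
as a genuine sum. *)
Lemma tmul_exact v k e : sharp e -> (e <= carrier (tmul v k)^⊥)%O ->
  (v ⊓ e)%:S *+ k = (tmul v k ⊓ e)%:S.
Proof.
move=> he hk.
suff: forall j, (j <= k)%N -> (v ⊓ e)%:S *+ j = (tmul v j ⊓ e)%:S by exact.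
elim=> [_|j IH jk].
  by rewrite mulr0n -zerotE; congr Some; apply/esym/le_ezero; exact: leIl.
rewrite mulrSr IH 1?ltnW // -(restr_addt he (tmulS v j)); congr (_ + _%:S).
have ve : (v ⊓ e <= (tmul v j)^⊥)%O.
  apply: le_on_sharp => //; rewrite [v ⊓ _]meetC.
  apply: (@disj_mono _ _ _ (carrier (tmul v k)^⊥)); rewrite ?lexx //.
  apply: carrier_disj; apply: disj_mono (tadd_excess (tmul v j) v) _ _ => //.
  exact/le_orthoC/(@tmul_nd _ _ v j.+1).
apply/le_anti; rewrite !lexI !leIr ve leIl /= andbT.
by rewrite (le_trans (leIl _ _)) ?leIr.
Qed.

(** If there were no such region, then, by [tadd_excess], [p] restricted to
[e] would fit into the complement of every truncated multiple of [p], hence be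
disjoint from its own carrier. *)
Lemma archimedean e p : locus e -> (e <= carrier p)%O ->
  exists n e1, [/\ locus e1, (e1 <= e)%O & (e1 <= tmul p n)%O].
Proof.
move=> [he e0] ep; apply: contrapT => hn.
have pe i : (p ⊓ e <= (tmul p i)^⊥)%O.
  apply: le_on_sharp => //; apply: contrapT => h0; apply: hn.
  exists i.+1, (carrier ((p ⊖ (p ⊓ (tmul p i)^⊥)) ⊓ e)); split.
  - exact: locus_carrier.
  - by apply: carrier_le => //; exact: leIr.
  apply: disj_le; rewrite meetC; apply: carrier_disj; rewrite meetC.
  rewrite [p ⊓ (_)^⊥]meetC.
  by apply: disj_mono (tadd_excess (tmul p i) p) _ _ => //; exact: leIl.
have ps := is_sup_ortho (carrierP p) pe.
have p0 : p ⊓ e = ezero.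
  apply: le_ezero; rewrite -(carrier_sharp p) lexI ps andbT.
  by apply: le_trans (leIl _ _) (le_carrier p).
by have := meet_carrier_neq0 e0 ep.
Qed.

(** A sequence decreasing to zero becomes at most [1/k] somewhere. If the
truncated multiples [tmul (v i) k] were full on [e] for all [i], then [e]
would be zero by [tmul_inf0]; where one of them is not full, it is a genuine
multiple. *)
Lemma vanishing_at (v : nat -> E) k e : locus e ->
  (forall i j, (i <= j)%N -> (v j <= v i)%O) ->
  (forall w, (forall i, (w <= v i)%O) -> w = ezero) ->
  exists i e1 m, [/\ locus e1, (e1 <= e)%O & (v i ⊓ e1)%:S *+ k = m%:S].
Proof.
move=> [he e0] vd v0.
have [i hi] : exists i, ~ (e <= tmul (v i) k)%O.
  apply: contrapT => hn; apply: e0; apply: (tmul_inf0 vd v0 (k := k)) => i.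
  by apply: contrapT => h; apply: hn; exists i.
set t := tmul (v i) k in hi; pose e1 := carrier (e ⊓ t^⊥).
exists i, e1, (t ⊓ e1); split.
- by apply: locus_carrier => h; apply: hi; exact: disj_le.
- by apply: carrier_le => //; exact: leIl.
apply: tmul_exact; first exact: carrier_sharp.
apply: carrier_le; first exact: carrier_sharp.
by apply: le_trans (leIr _ _) (le_carrier _).
Qed.

End SigmaTheory.

(** * Approximate states by counting copies of a small element *)

Section Division.
Variables (d : Order.disp_t) (E : sigmaMVEffectAlgebraType d).
Implicit Types (a b c e g p q r v w : E) (x y z : totalization E).

Lemma tmul_le_muln e g n m : sharp e -> (g ⊓ e)%:S *+ n = m%:S ->
  (tmul g n ⊓ e <= m)%O.
Proof.
move=> he; elim: n m => [|n IH] m.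
  by move=> _; apply: le_trans (leIl _ _) (ezero_le _).
rewrite mulrSr => h; have [m' [_ [hm' _]]] := addt_defined h.
have := restr_addt he (tmulS g n); rewrite hm' in h.
by move=> /(addt_le2 (IH _ hm') _) h'; apply: h' h; rewrite leI2 ?leIr.
Qed.

Lemma scale_neq0 g n e : locus e -> (e <= tmul g n)%O -> g ⊓ e <> ezero.
Proof.
move=> [_ e0] he h; apply: e0; apply: le_ezero.
by rewrite -(@tmul_disj _ _ e g n) ?lexI ?lexx // meetC.
Qed.

(** Division with remainder by the scale [g]. The bound [e <= tmul g n] says
that [n] copies of [g] cover the region, so the number of copies of [g] that
fit into [a] on some smaller region is at most [n]. Take the largest such
number: on that region [g] cannot lie below the remainder anywhere, so by
[compare_at] the remainder lies below [g]. *)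
Lemma division_at e g n a : locus e -> (e <= tmul g n)%O ->
  exists k r e1, [/\ locus e1, (e1 <= e)%O, (r <= g ⊓ e1)%O
    & (a ⊓ e1)%:S = (g ⊓ e1)%:S *+ k + r%:S].
Proof.
move=> le en.
pose P k := `[< exists e1 x, [/\ locus e1, (e1 <= e)%O
  & (g ⊓ e1)%:S *+ k + x = (a ⊓ e1)%:S] >].
have P0 : exists k, P k.
  exists 0%N; apply/asboolP; exists e, (a ⊓ e)%:S.
  by split; rewrite // mulr0n add0r.
have Pn k : P k -> (k <= n)%N.
  move=> /asboolP[e1 [x [le1 e1e h]]]; rewrite leqNgt; apply/negP => nk.
  have e1n := le_trans e1e en.
  have hk : (g ⊓ e1)%:S *+ n + (g ⊓ e1)%:S +
      ((g ⊓ e1)%:S *+ (k - n.+1) + x) = (a ⊓ e1)%:S.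
    by rewrite -h -mulrSr addrA -mulrnDr subnKC.
  have [s [_ [hs _]]] := addt_defined hk; rewrite hs in hk.
  have se : (s <= e1)%O by apply: le_trans (addt_le hk) (leIr _ _).
  have [m [_ [hm _]]] := addt_defined hs; rewrite hm in hs.
  have := tmul_le_muln le1.1 hm; rewrite meet_r // => em.
  have ms : s = m by apply/le_anti; rewrite (le_trans se em) (addt_le hs).
  move: hs; rewrite ms => /addt_id h0.
  by apply: (scale_neq0 le1 e1n); exact: defined_inj.
have [k /asboolP[e1 [x [le1 e1e h]]] kmax] := ex_maxnP P0 Pn.
have [r [r0 [er _]]] := addt_defined (addt_comm h); subst x.
have [rg|[e2 [le2 e21 gr]]] := compare_at r g le1.
  exists k, (r ⊓ e1), e1; split=> //; first by rewrite lexI rg leIr.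
  have [m [_ [hm _]]] := addt_defined h; rewrite hm in h.
  have := restr_muln le1.1 hm; rewrite -meetA meetxx => ->.
  by rewrite (restr_addt le1.1 h) -meetA meetxx.
(* On [e2] one more copy of [g] fits, against the choice of [k]. *)
suff /kmax : P k.+1 by rewrite ltnn.
have [m [_ [hm _]]] := addt_defined h; rewrite hm in h.
have := restr_muln le2.1 hm; rewrite meet_restr // => hm2.
have := restr_addt le2.1 h; rewrite meet_restr // -hm2 => h2.
have /esubK hg : (g ⊓ e2 <= r ⊓ e2)%O by rewrite lexI gr leIr.
apply/asboolP; exists e2, ((r ⊓ e2) ⊖ (g ⊓ e2))%:S; split=> //.
  exact: le_trans e21 e1e.
by rewrite mulrSr -addrA hg.
Qed.

(** The discrete case: [g] is locally an atom. *)
Definition unhalvable g := forall h x, h%:S *+ 2 + x = g%:S -> h = ezero.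

(** On a smaller region one of the remainder [r] and its complement in [g] is
below the other; twice the smaller one is then below [g], so it is zero, and
the remainder is either nothing or a full copy of [g]. *)
Lemma division_exact e g n a : unhalvable g -> locus e -> (e <= tmul g n)%O ->
  exists k e1, [/\ locus e1, (e1 <= e)%O
    & (a ⊓ e1)%:S = (g ⊓ e1)%:S *+ k].
Proof.
move=> ug le en; have [k [r [e1 [le1 e1e rg h]]]] := division_at a le en.
have hr := esubK rg; set r2 := _ ⊖ r in hr.
(* The smaller of two parts of a restriction of [g] is zero. *)
have half e' s t : s%:S + t%:S = (g ⊓ e')%:S -> (s <= t)%O -> s = ezero.
  move=> hst /esubK ht; apply: (ug s ((t ⊖ s)%:S + (g ⊖ (g ⊓ e'))%:S)).
  by rewrite addrA mulr2n -[s%:S + _ + _]addrA ht hst esubK // leIl.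
have [rr|[e2 [le2 e21 rr]]] := compare_at r r2 le1.
  exists k, e1; split=> //.
  rewrite h (half e1 r r2) ?zerotE ?addr0 //.
  by rewrite meet_l // in rr; exact: le_trans rg (leIr _ _).
exists k.+1, e2; split=> //; first exact: le_trans e21 e1e.
have := restr_addt le2.1 hr; rewrite meet_restr // => hr2.
have r20 : r2 ⊓ e2 = ezero.
  by apply: (half e2 _ (r ⊓ e2)); rewrite 1?addrC // lexI rr leIr.
rewrite r20 zerotE addr0 in hr2.
have [m [_ [hm _]]] := addt_defined (esym h); rewrite hm in h.
have := restr_muln le2.1 hm; rewrite meet_restr // => hm2.
have := restr_addt le2.1 (esym h).
by rewrite meet_restr // -hm2 hr2 -mulrSr => ->.
Qed.

(** If some nonzero [g] below [e] has [N] copies with a defined sum, it will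
do. Otherwise take a nonzero [g] with the largest possible number of copies: a
nonzero [h] with [h + h] below [g] would have at least twice as many. *)
Lemma scale_exists e N : locus e -> exists g e1 n,
  [/\ locus e1, (e1 <= e)%O, (e1 <= tmul g n)%O
    & unhalvable g \/ exists m, g%:S *+ N = m%:S].
Proof.
move=> le.
have loc g : g <> ezero -> (g <= e)%O -> exists e1 n,
    [/\ locus e1, (e1 <= e)%O & (e1 <= tmul g n)%O].
  move=> g0 ge.
  have [n [e1 [? e1s ?]]] := archimedean (locus_carrier g0) (lexx _).
  by exists e1, n; split=> //; apply: le_trans e1s (carrier_le le.1 ge).
pose D k := `[< exists g, [/\ g <> ezero, (g <= e)%O
  & exists m, g%:S *+ k = m%:S] >].
have [/asboolP[g [g0 ge gm]]|DN] := boolP (D N).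
  by have [e1 [n [? ? ?]]] := loc g g0 ge; exists g, e1, n; split=> //; right.
have D0 : exists k, D k.
  exists 0%N; apply/asboolP; exists e.
  by split=> //; [exact: le.2|exists ezero].
have Dle k : D k -> (k <= N)%N.
  move=> /asboolP[g [g0 ge [m gm]]]; rewrite leqNgt; apply/negP => Nk.
  move: DN => /asboolP; apply; exists g; split=> //.
  move: gm; rewrite -(subnKC (ltnW Nk)) mulrnDr => /addt_defined[m' [_ [hm _]]].
  by exists m'.
have [k /asboolP[g [g0 ge [m gm]]] kmax] := ex_maxnP D0 Dle.
have k0 : (0 < k)%N.
  apply: kmax; apply/asboolP; exists e; split=> //; first exact: le.2.
  by exists e; rewrite mulr1n.
have [e1 [n [? ? ?]]] := loc g g0 ge; exists g, e1, n; split=> //; left.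
move=> h x hx; apply: contrapT => h0.
suff /kmax : D (2 * k)%N by lia.
apply/asboolP; exists h; split=> //.
  by apply: le_trans ge; move: hx; rewrite mulr2n -addrA => /addt_le.
move: gm; rewrite -hx mulrnDl -mulrnA => /addt_defined[m' [_ [hm _]]].
by exists m'.
Qed.

(** Were [k] larger than [l + j], cancelling [l] copies of [g] would put more
than [j] copies of [g] below [y], which is itself below [j] copies. *)
Lemma count_le g x y z s k l j : g <> ezero ->
  g%:S *+ k + x = s%:S -> g%:S *+ l + y = s%:S -> y + z = g%:S *+ j ->
  (k <= l + j)%N.
Proof.
move=> g0 hk hl hy; rewrite leqNgt; apply/negP => ljk.
have e1 : g%:S *+ l +
    (g%:S *+ j + (g%:S + g%:S *+ (k - (l + j).+1) + x)) = s%:S.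
  by rewrite !addrA -mulrnDr -mulrSr -mulrnDr subnKC.
have e2 := addtI e1 hl.
have [w [t [hw ht]]] : exists w t, g%:S *+ j = w%:S /\
    g%:S + g%:S *+ (k - (l + j).+1) + x = t%:S.
  have [_ [t [_ ht]]] := addt_defined e1.
  by have [w [t' [-> ->]]] := addt_defined ht; exists w, t'.
rewrite -e2 hw -addrA in hy; have := addt_id hy.
rewrite -!addrA => h0.
have := addt_le (c := ezero) h0.
by move/le_ezero.
Qed.

(** The two admissible remainders, according to whether the scale is
unhalvable ([exact = true]) or only small. *)
Definition small_rem (exact : bool) g r :=
  if exact then r = ezero else (r <= g)%O.

Definition quotient_of ex g a k :=
  exists2 r, small_rem ex g r & a%:S = g%:S *+ k + r%:S.

Lemma small_remP ex g r : small_rem ex g r ->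
  exists z, r%:S + z = g%:S *+ (~~ ex).
Proof.
case: ex => /= [->|/esubK h]; last by exists (g ⊖ r)%:S; rewrite mulr1n.
by exists 0; rewrite mulr0n addr0.
Qed.

Lemma quotient_restr ex g e e1 a k : sharp e1 -> (e1 <= e)%O ->
  quotient_of ex (g ⊓ e) (a ⊓ e) k -> quotient_of ex (g ⊓ e1) (a ⊓ e1) k.
Proof.
move=> he1 e1e [r hr h]; exists (r ⊓ e1).
  case: ex hr => /= [->|rg]; first by apply: le_ezero; exact: leIl.
  by rewrite -(meet_restr g e1e) leI2.
have [m [_ [hm _]]] := addt_defined (esym h); rewrite hm in h.
have := restr_muln he1 hm; rewrite meet_restr // => ->.
by have := restr_addt he1 (esym h); rewrite meet_restr.
Qed.

(** Quotients survive the passage to a smaller region ([quotient_restr]), so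
finitely many divisions can be carried out one after the other. *)
Lemma common_quotients (ex : bool) g n e (S : seq E) : locus e ->
  (e <= tmul g n)%O -> (ex -> unhalvable g) ->
  exists e1, [/\ locus e1, (e1 <= e)%O
    & forall a, a \in S -> exists k, quotient_of ex (g ⊓ e1) (a ⊓ e1) k].
Proof.
move=> le en hex; elim: S => [|a S [e1 [le1 e1e IH]]]; first by exists e.
have [k [e2 [le2 e21 h2]]] : exists k e2, [/\ locus e2, (e2 <= e1)%O
    & quotient_of ex (g ⊓ e2) (a ⊓ e2) k].
  case: ex hex {IH} => [/(_ isT) ug|_].
    have [k [e2 [? ? h2]]] := division_exact a ug le1 (le_trans e1e en).
    by exists k, e2; split=> //; exists ezero; rewrite // zerotE addr0.
  have [k [r [e2 [? ? ? h2]]]] := division_at a le1 (le_trans e1e en).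
  by exists k, e2; split=> //; exists r.
exists e2; split=> //; first exact: le_trans e21 e1e.
move=> b; rewrite in_cons => /predU1P[->|/IH[l hl]]; first by exists k.
by exists l; apply: quotient_restr hl; [exact: le2.1|].
Qed.

(** The error does not grow with the quotients, so that it becomes negligible
after division by a large quotient of [eone]. *)
Lemma quotient_add ex g a b c ka kb kc : g <> ezero -> a%:S + b%:S = c%:S ->
  quotient_of ex g a ka -> quotient_of ex g b kb -> quotient_of ex g c kc ->
  (ka + kb <= kc + ~~ ex)%N /\ (kc <= ka + kb + (~~ ex).*2)%N.
Proof.
move=> g0 habc [ra /small_remP[za hza] ha] [rb /small_remP[zb hzb] hb]
  [rc /small_remP[zc hzc] hc].
have hab : g%:S *+ (ka + kb) + (ra%:S + rb%:S) = c%:S.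
  by rewrite mulrnDr addrACA -ha -hb.
split; first exact: count_le hab (esym hc) hzc.
apply: (count_le g0 (esym hc) hab (z := za + zb)).
by rewrite addrACA hza hzb -mulrnDr addnn.
Qed.

Lemma quotient_le ex g a b ka kb : g <> ezero -> (a <= b)%O ->
  quotient_of ex g a ka -> quotient_of ex g b kb -> (ka <= kb + ~~ ex)%N.
Proof.
move=> g0 /esubK hab [ra _ ha] [rb /small_remP[zb hzb] hb].
by rewrite ha -addrA in hab; exact: count_le hab (esym hb) hzb.
Qed.

(** [f a] is the quotient of [a] by the scale divided by the quotient of
[eone]. The former are additive up to two units and the latter is at least
[N.+1], or else all quotients are exact. Since [f a] depends only on the
restriction of [a] to the region, it is [1] for every [a] above [e]. *)
Lemma approx_state (R : realType) e (S : seq E) N : locus e ->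
  exists f : E -> R, [/\ forall a, 0 <= f a <= 2,
    forall a, (e <= a)%O -> f a = 1
    & forall a b c, a \in S -> b \in S -> c \in S -> a%:S + b%:S = c%:S ->
      `|f a + f b - f c| <= 2 / N.+1%:R].
Proof.
(* If [N.+2] copies fit into a region, its quotient, which may be one less
because of the remainder, is at least [N.+1]. *)
move=> le; have [g [e1 [n [le1 e1e e1n hg]]]] := scale_exists N.+2 le.
have [ex [hu hN]] : exists ex : bool, (ex -> unhalvable g) /\
    (~~ ex -> exists m, g%:S *+ N.+2 = m%:S).
  by case: hg => h; [exists true|exists false].
have [e2 [le2 e21 hS]] := common_quotients (eone :: S) le1 e1n hu.
have g0 := scale_neq0 le2 (le_trans e21 e1n).
pose kk a := xget 0%N [set k | quotient_of ex (g ⊓ e2) a k].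
have kkP a : a \in S -> quotient_of ex (g ⊓ e2) (a ⊓ e2) (kk (a ⊓ e2)).
  move=> aS; have [k hk] := hS a (mem_behead (s := eone :: S) aS).
  by rewrite /kk; case: xgetP => [//|/(_ k)].
have e2E : eone ⊓ e2 = e2 by apply: meet_r; exact: le_eone.
have hK : quotient_of ex (g ⊓ e2) e2 (kk e2).
  have [k] := hS _ (mem_head _ _); rewrite e2E => hk.
  by rewrite /kk; case: xgetP => [//|/(_ k)].
have kk_le a : (kk (a ⊓ e2) <= kk e2 + ~~ ex)%N.
  rewrite {1}/kk; case: xgetP => [k _ hk|//].
  by apply: quotient_le g0 _ hk hK; exact: leIr.
have KN : ~~ ex -> (N.+1 <= kk e2)%N.
  move=> nex; have [m hm] := hN nex; have hm2 := restr_muln le2.1 hm.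
  have /esubK := leIr e2 m; rewrite -hm2 => hx.
  have [r /small_remP[z hz] hr] := hK.
  by have := count_le g0 hx (esym hr) hz; rewrite nex addn1.
have K0 : (0 < kk e2)%N.
  case: (boolP ex) => [hex|/KN]; last exact: leq_trans.
  rewrite lt0n; apply/eqP => k0; move: hK; rewrite k0 hex => -[r /= ->].
  by rewrite mulr0n add0r => /defined_inj; exact: le2.2.
pose K : R := (kk e2)%:R.
exists (fun a => (kk (a ⊓ e2))%:R / K); split.
- move=> a; rewrite divr_ge0 ?ler0n //= ler_pdivrMr ?ltr0n //.
  by rewrite -natrM ler_nat (leq_trans (kk_le a)) //; lia.
- move=> a ea; rewrite meet_r ?divff ?pnatr_eq0 -?lt0n //.
  by apply: le_trans ea; apply: le_trans e21 e1e.
move=> a b c aS bS cS habc.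
have [h1 h2] := quotient_add g0 (restr_addt le2.1 habc) (kkP a aS) (kkP b bS)
  (kkP c cS).
rewrite -mulrDl -mulrBl normrM normfV [`|K|]ger0_norm ?ler0n //.
rewrite ler_pdivrMr ?ltr0n // mulrAC ler_pdivlMr ?ltr0n //.
have [hex|nex] := boolP ex.
  have -> : kk (c ⊓ e2) = (kk (a ⊓ e2) + kk (b ⊓ e2))%N.
    by move: h1 h2; rewrite hex /=; lia.
  by rewrite natrD subrr normr0 mul0r mulr_ge0 ?ler0n.
apply: ler_pM; rewrite ?normr_ge0 ?ler0n ?ler_nat ?KN //.
have r1 : (kk (a ⊓ e2) + kk (b ⊓ e2))%:R <= (kk (c ⊓ e2) + 1)%:R :> R.
  by rewrite ler_nat; move: h1; rewrite nex.
have r2 : (kk (c ⊓ e2))%:R <= (kk (a ⊓ e2) + kk (b ⊓ e2) + 2)%:R :> R.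
  by rewrite ler_nat; move: h2; rewrite nex.
by move: r1 r2; rewrite ler_norml !natrD => ? ?; lra.
Qed.

End Division.

(** * States, and separation by states preserving countably many joins *)

Definition is_state (R : realType) (d : Order.disp_t) (E : effectAlgebraType d)
    (w : E -> R) : Prop :=
  [/\ forall a, 0 <= w a, w eone = 1
    & forall a b c, a%:S + b%:S = c%:S -> w c = w a + w b].

Section StateTheory.
Variables (R : realType) (d : Order.disp_t) (E : effectAlgebraType d).
Variables (w : E -> R) (hw : is_state w).
Implicit Types (a b c e p : E).

Lemma state_ge0 a : 0 <= w a. Proof. by case: hw. Qed.

Lemma state1 : w eone = 1. Proof. by case: hw. Qed.

Lemma state_add a b c : a%:S + b%:S = c%:S -> w c = w a + w b.
Proof. by case: hw => _ _; exact. Qed.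

Lemma state0 : w ezero = 0.
Proof.
have /state_add : (ezero : E)%:S + (ezero : E)%:S = (ezero : E)%:S.
  by rewrite zerotE addr0.
by move=> h; lra.
Qed.

Lemma state_le a b : (a <= b)%O -> w a <= w b.
Proof. by move=> /esubK/state_add ->; rewrite lerDl state_ge0. Qed.

Lemma state_ortho a : w a^⊥ = 1 - w a.
Proof. by rewrite -state1 (state_add (addt_ortho a)) addrC addKr. Qed.

Lemma state_le1 a : w a <= 1.
Proof. by rewrite -state1; apply: state_le; exact: le_eone. Qed.

Lemma state_sub a b : (a <= b)%O -> w (b ⊖ a) = w b - w a.
Proof. by move=> /esubK/state_add ->; rewrite addrC addKr. Qed.

Lemma state_muln a k m : a%:S *+ k = m%:S -> w m = w a *+ k.
Proof.
elim: k m => [m|k IH m].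
  rewrite !mulr0n => h; rewrite -state0; congr w.
  by apply: defined_inj; rewrite -h.
rewrite !mulrS => h; have [_ [n [_ hn]]] := addt_defined h.
by rewrite -(IH n hn); apply: state_add; rewrite -hn.
Qed.
End StateTheory.

Section StateMV.
Variables (R : realType) (d : Order.disp_t) (E : mvEffectAlgebraType d).
Variables (w : E -> R) (hw : is_state w).
Implicit Types (a b c e p : E).

Lemma state_tmul p n : w (tmul p n) <= w p *+ n.
Proof.
elim: n => [|n IH]; first by rewrite mulr0n /= (state0 hw).
rewrite (state_add hw (tmulS p n)) mulrSr lerD //.
by apply: state_le => //; exact: leIr.
Qed.

(** A state with value one on a sharp element does not see the complement. *)
Lemma state_carrier e a : sharp e -> w e = 1 -> w (a ⊓ e) = w a.
Proof.
move=> he e1; rewrite (state_add hw (sharp_split a he)).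
suff -> : w (a ⊓ e^⊥) = 0 by rewrite addr0.
apply/le_anti; rewrite state_ge0 // andbT.
have <- : w e^⊥ = 0 by rewrite (state_ortho hw) e1 subrr.
by apply: state_le => //; exact: leIr.
Qed.
End StateMV.

Section StateExistence.
Variables (R : realType) (d : Order.disp_t) (E : sigmaMVEffectAlgebraType d).
Implicit Types (a b c e : E).

(** Index approximate states by a finite set of elements and an accuracy, and
take limits along an ultrafilter containing, for every finite set and
accuracy, all finer indices. The limits exist because the values stay in a
compact interval, and all errors disappear in the limit. *)
Lemma state_exists (e : nat -> E) : (forall n, locus (e n)) ->
  (forall n, (e n.+1 <= e n)%O) ->
  exists w : E -> R, is_state w /\ forall n, w (e n) = 1.
Proof.
move=> le ed.
have ed' m n : (m <= n)%N -> (e n <= e m)%O.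
  by move=> /subnK <-; elim: (n - m)%N => //= k IH; exact: le_trans (ed _) IH.
pose I := (seq E * nat)%type.
pose f (i : I) : E -> R := sval (cid (approx_state R i.1 i.2 (le i.2))).
have fP (i : I) := svalP (cid (approx_state R i.1 i.2 (le i.2))).
have {fP} [f02 f1 fadd] : [/\ forall i a, 0 <= f i a <= 2,
    forall i a, (e i.2 <= a)%O -> f i a = 1
    & forall i a b c, a \in i.1 -> b \in i.1 -> c \in i.1 ->
      a%:S + b%:S = c%:S -> `|f i a + f i b - f i c| <= 2 / i.2.+1%:R].
  by split=> i; have [] := fP i.
pose B (i : I) : set I := [set j | {subset i.1 <= j.1} /\ (i.2 <= j.2)%N].
have FB : ProperFilter (filter_from setT B).
  apply: filter_from_proper; last by move=> i _; exists i; split.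
  apply: filter_fromT_filter; first by exists ([::], 0%N).
  move=> i j; exists (i.1 ++ j.1, maxn i.2 j.2) => k [] /=.
  rewrite geq_max => h /andP[h1 h2]; split; split=> // x hx; apply: h.
    by rewrite mem_cat hx.
  by rewrite mem_cat hx orbT.
have [G [GU sG]] := ultraFilterLemma FB.
have GB i : G (B i) by apply: sG; exists i.
have GP : ProperFilter G by exact: ultra_proper.
have GI A A' : G A -> G A' -> G (A `&` A') by exact: filterI.
have Gex A : G A -> exists i, A i by exact: filter_ex.
(* A cluster point along an ultrafilter is a limit. *)
have hlim a : exists p : R, forall eps : R, 0 < eps ->
    G [set i | `|f i a - p| < eps].
  have /(_ (f^~ a @ G)) := @segment_compact R 0 2.
  case.
    by apply: (@filterE I G) => i; rewrite /= in_itv /= f02.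
  move=> p [_ hp]; exists p => eps e0.
  have [//|h] := in_ultra_setVsetC [set i | `|f i a - p| < eps] GU.
  have hG : (f^~ a @ G) [set f i a | i in ~` [set i | `|f i a - p| < eps]].
    by apply: (@filterS I G _ _ _ _ h) => i hi /=; exists i.
  have [x []] := hp _ _ hG (@nbhsx_ballx R R^o p eps e0).
  by move=> [i hi <-]; rewrite /ball /= distrC => /hi.
pose w a := sval (cid (hlim a)).
have wP a eps : 0 < eps -> G [set i | `|f i a - w a| < eps].
  exact: (svalP (cid (hlim a))).
have w1 n a : (e n <= a)%O -> w a = 1.
  move=> ha; apply/eqP; rewrite -subr_eq0 -normr_le0.
  apply/ler_addgt0Pl => eps e0; rewrite addr0 distrC.
  have /Gex[i [hi [_ ni]]] := GI _ _ (wP a _ e0) (GB ([::], n)).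
  have <- : f i a = 1 by apply: f1; exact: le_trans (ed' _ _ ni) ha.
  exact: ltW.
exists w; split; last by move=> n; exact: (w1 n).
split; last 1 first.
- move=> a b c habc; apply/eqP; rewrite eq_sym -subr_eq0 -normr_le0.
  apply/ler_addgt0Pl => eps e0; rewrite addr0.
  have e4 : 0 < eps / 4 by lra.
  have [n hn] : exists n, 2 / n.+1%:R <= eps / 4 :> R.
    have e8 : 0 < eps / 4 / 2 by lra.
    have [n hn] := ltr_add_invr e8; rewrite add0r in hn.
    by exists n; rewrite mulrC -ler_pdivlMr // ltW.
  have /Gex[i [[[ha hb] hc] [si ni]]] := GI _ _
    (GI _ _ (GI _ _ (wP a _ e4) (wP b _ e4)) (wP c _ e4))
    (GB ([:: a; b; c], n)).
  have := fadd i a b c; rewrite !si ?inE ?eqxx ?orbT //.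
  move=> /(_ isT isT isT habc).
  have : 2 / i.2.+1%:R <= 2 / n.+1%:R :> R.
    by rewrite ler_pM2l // lef_pV2 ?posrE ?ltr0n // ler_nat.
  move: ha hb hc; rewrite /= !ltr_norml !ler_norml.
  move: hn; set x := _ / _; set y := _ / _.
  move=> ? /andP[? ?] /andP[? ?] /andP[? ?] ? /andP[? ?].
  by apply/andP; split; lra.
- move=> a; apply/ler_addgt0Pl => eps e0.
  have /Gex[i hi] := wP a _ e0; move: hi (f02 i a).
  by rewrite /= ltr_norml => /andP[? ?] /andP[? ?]; lra.
- by apply: (w1 0%N); exact: le_eone.
Qed.

(** The first region is one where [n] copies of the excess of [a] over [b]
cover everything, so that the excess has value at least [1/n] while [b] has no
excess over [a] there. The later regions run through all pairs [(n, k)] and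
make the value of the defect of the [n]-th join, at some index, at most [1/k].
*)
Lemma separating_state (u : nat -> nat -> E) (s : nat -> E) a b :
  (forall n, is_sup (u n) (s n)) ->
  (forall n i j, (i <= j)%N -> (u n i <= u n j)%O) -> ~ (a <= b)%O ->
  exists w : E -> R, [/\ is_state w, w b < w a
    & forall n eps, 0 < eps -> exists i, w (s n) <= w (u n i) + eps].
Proof.
move=> us und ab.
pose c1 := a ⊖ (a ⊓ b).
have c1n0 : c1 <> ezero by move=> /esubI_eq0.
have [N [e0 [le0 e0s e0N]]] := archimedean (locus_carrier c1n0) (lexx _).
(* Stage [j] of the construction treats the pair encoded by [j]. *)
pose good (j : nat) e := if unpickle j is Some (n, k) then
  exists i m, ((s n ⊖ u n i) ⊓ e)%:S *+ k = m%:S else True.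
have step (x : {e | locus e} * nat) : {y : {e | locus e} * nat |
    [/\ y.2 = x.2.+1, (sval y.1 <= sval x.1)%O & good x.2 (sval y.1)]}.
  apply: cid; case: x => -[e le] j /=; rewrite /good.
  case: (unpickle j) => [[n k]|]; last by exists (exist _ e le, j.+1).
  have us_le i : (u n i <= s n)%O by exact: is_sup_ub.
  have [||i [e1 [m [le1 ? ?]]]] :=
    vanishing_at k (v := fun i => s n ⊖ u n i) le.
  - by move=> i1 i2 ii; apply: esub_monol => //; exact: und.
  - move=> v hv; have vs : (v <= s n)%O.
      by apply: le_trans (hv 0%N) (esub_le _).
    have sv : (s n <= s n ⊖ v)%O.
      apply: (is_sup_least (us n)) => i.
      by rewrite -(esubKl (us_le i)) esub_monol // esub_le.
    have hs := addt_comm (esubK vs).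
    have es : s n ⊖ v = s n by apply/le_anti; rewrite sv esub_le.
    by rewrite es in hs; apply: defined_inj; exact: addt_id hs.
  by exists (exist _ e1 le1, j.+1); split=> //; exists i, m.
have [x [x0 xS]] := dependent_choice step (exist _ e0 le0, 0%N).
pose e n := sval (x n).1.
have x2 n : (x n).2 = n.
  by elim: n => [|n IH]; [rewrite x0|have [-> _ _] := xS n; rewrite IH].
have lex n : locus (e n) by exact: svalP (x n).1.
have [|w [hw we]] := state_exists lex; first by move=> n; have [] := xS n.
have ee0 : e 0%N = e0 by rewrite /e x0.
exists w; split=> //.
- have wd : w b <= w (a ⊓ b).
    rewrite -(state_carrier hw b (lex 0%N).1 (we 0%N)) ee0.
    apply: (state_le hw); rewrite lexI leIl andbT.
    apply: le_trans (le_on_carrier a b).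
    by apply: leI2.
  have := state_add hw (esubK (leIl a b)); rewrite -/c1 => hc.
  suff : 0 < w c1 by move=> ?; lra.
  rewrite lt_neqAle state_ge0 // andbT; apply/eqP => w0.
  have := le_trans (state_le hw e0N) (state_tmul hw c1 N).
  by rewrite -w0 mul0rn -ee0 we; lra.
- move=> n eps eps0.
  have [k hk] := ltr_add_invr eps0; rewrite add0r in hk.
  (* The stage with [k.+1] copies, as [1/k.+1 < eps]. *)
  have := xS (pickle (n, k.+1)) => -[_ _]; rewrite x2 /good pickleK.
  move=> [i [m hm]]; exists i.
  set e1 := sval _ in hm; have he1 : locus e1 by exact: lex.
  have we1 : w e1 = 1 by exact: (we (pickle (n, k.+1)).+1).
  have hus : (u n i <= s n)%O by exact: is_sup_ub.
  have := state_muln hw hm.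
  rewrite (state_carrier hw _ he1.1 we1) (state_sub hw hus) => hwm.
  have := state_le1 hw m; rewrite hwm -mulr_natr => h.
  rewrite addrC -lerBlDr; apply: ltW; apply: le_lt_trans hk.
  by rewrite -[_^-1]mul1r ler_pdivlMr ?ltr0n.
Qed.

End StateExistence.

(** * The probability measure of a left-continuous distribution function *)

Lemma halfline_bigcup (R : realType) (t : R) :
  `]-oo, t[%classic = \bigcup_n `]-oo, t - n.+1%:R^-1]%classic.
Proof.
apply/seteqP; split=> s /=; rewrite in_itv /=.
  move=> st; have [n hn] := ltr_add_invr st.
  by exists n => //=; rewrite in_itv /= lerBrDr ltW.
move=> [n _] /=; rewrite in_itv /= => /le_lt_trans; apply.
by rewrite ltrBlDr ltrDl invr_gt0 ltr0n.
Qed.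

Section LeftCDF.
Variables (R : realType) (G : R -> R) (lo hi : R).
Hypothesis G_nd : forall s t, s <= t -> G s <= G t.
Hypothesis G_lo : forall t, t <= lo -> G t = 0.
Hypothesis G_hi : forall t, hi <= t -> G t = 1.

Let F (t : R) : R := inf [set G s | s in [set s | t < s]].

Let F_inf t : has_inf [set G s | s in [set s | t < s]].
Proof.
split; first by exists (G (t + 1)), (t + 1) => //=; rewrite ltrDl.
by exists (G t) => _ [s /= ts <-]; apply: G_nd; exact: ltW.
Qed.

Let G_le_F t : G t <= F t.
Proof.
apply: lb_le_inf; first exact: (F_inf t).1.
by move=> _ [s /= ts <-]; apply: G_nd; exact: ltW.
Qed.

Let F_le_G s t : s < t -> F s <= G t.
Proof. by move=> st; apply: ge_inf; [exact: (F_inf s).2|exists t]. Qed.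

Let F_nd : nondecreasing F.
Proof.
move=> s t; rewrite le_eqVlt => /predU1P[->//|st].
exact: le_trans (F_le_G st) (G_le_F t).
Qed.

Let F_rc : right_continuous F.
Proof.
move=> t; apply/cvgrPdist_lt => eps e0.
have [_ [s /= ts <-] hs] := inf_adherent e0 (F_inf t).
near=> u.
have tu : t < u by near: u; exact: nbhs_right_gt.
have us : u < s by near: u; exact: nbhs_right_lt.
rewrite ltr_distlC; have := F_nd (ltW tu); have := F_le_G us.
by move=> h1 h2; apply/andP; split; [lra|exact: le_lt_trans h1 hs].
Unshelve. all: by end_near. Qed.

Let F_cvgN : F @ -oo --> (0 : R).
Proof.
apply/cvgrPdist_lt => eps e0; near=> t.
have tl : t < lo by near: t; exact: nbhs_ninfty_lt (num_real _).
have -> : F t = 0.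
  apply/le_anti; rewrite -{1}(G_lo (lexx lo)) F_le_G //=.
  by rewrite -(G_lo (ltW tl)) G_le_F.
by rewrite subr0 normr0.
Unshelve. all: by end_near. Qed.

Let F_cvgy : F @ +oo --> (1 : R).
Proof.
apply/cvgrPdist_lt => eps e0; near=> t.
have tl : hi < t by near: t; exact: nbhs_pinfty_gt (num_real _).
have -> : F t = 1.
  apply/le_anti; rewrite -{1}(@G_hi (t + 1)) ?F_le_G //=; try lra.
  by rewrite -{1}(G_hi (ltW tl)) G_le_F.
by rewrite subrr normr0.
Unshelve. all: by end_near. Qed.

(** The Lebesgue-Stieltjes measure of the right-continuous modification [F] of
[G]. The open half-line up to [t] has as its measure the left limit of [F] at
[t], which is also that of [G]; hence the value is [G t] wherever [G] is
left-continuous, and only there is it claimed. *)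
Lemma left_cdf_measure : exists mu : probability (measurableTypeR R) R,
  forall t,
    (forall eps, 0 < eps -> exists n, G t <= G (t - n.+1%:R^-1) + eps) ->
    mu `]-oo, t[%classic = (G t)%:E.
Proof.
pose f : cumulativeBounded (0 : R) (1 : R) :=
  HB.pack_for (cumulativeBounded (0 : R) (1 : R)) F
   (isCumulative.Build R _ R F F_nd F_rc)
   (isCumulativeBounded.Build R 0 1 F F_cvgN F_cvgy).
pose mu : probability (measurableTypeR R) R := lebesgue_stieltjes_measure f.
have muE r : mu `]-oo, r]%classic = (F r)%:E.
  have := cdf_lebesgue_stieltjes_id f r.
  by rewrite /cdf /distribution /pushforward preimage_id.
exists mu => t hG.
have inv_gt0 n : 0 < (n.+1%:R : R)^-1 by rewrite invr_gt0 ltr0n.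
apply/le_anti/andP; split; last first.
  apply/lee_addgt0Pr => eps e0; have [n hn] := hG eps e0.
  apply: (@le_trans _ _ ((F (t - n.+1%:R^-1))%:E + eps%:E)%E).
    by rewrite -EFinD lee_fin (le_trans hn) // lerD2r G_le_F.
  rewrite leeD2r // -muE le_measure ?inE //.
  by apply: subset_itvl; rewrite bnd_simp ltrBlDr ltrDl.
rewrite halfline_bigcup.
have cv : (mu \o (fun n => `]-oo, t - n.+1%:R^-1]%classic)) @ \oo -->
    mu (\bigcup_n `]-oo, t - n.+1%:R^-1]%classic).
  apply: nondecreasing_cvg_mu => //; first exact: bigcup_measurable.
  move=> m n mn; apply/subsetPset/subset_itvl; rewrite bnd_simp.
  by rewrite lerB // lef_pV2 ?posrE ?ltr0n // ler_nat.
apply: (cvge_le _ cv); apply: nearW => n /=.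
rewrite [leLHS]muE lee_fin F_le_G // ltrBlDr ltrDl //.
Qed.

End LeftCDF.

(** * From a spectral resolution to the values of Borel sets *)

Local Notation is_borel R := (@measurable _ (measurableTypeR R)).

Lemma countable_setU T (A B : set T) :
  countable A -> countable B -> countable (A `|` B).
Proof.
move=> cA cB; rewrite -bigcup2E; apply: bigcup_countable => // i _.
by case: i => [//|[//|i]]; exact: countable0.
Qed.

(** Open half-lines are closed under intersection and generate the Borel sets,
so this is Dynkin's theorem, with disjoint countable unions split into
disjoint binary ones and increasing ones, the operations for which observables
have axioms. *)
Lemma borel_induction (R : realType) (P : set R -> Prop) :
  P setT -> (forall t, P `]-oo, t[%classic) ->
  (forall A, is_borel R A -> P A -> P (~` A)) ->
  (forall A B, is_borel R A ->
    is_borel R B -> A `&` B = set0 ->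
    P A -> P B -> P (A `|` B)) ->
  (forall A : nat -> set R,
    (forall n, is_borel R (A n)) ->
    (forall n, A n `<=` A n.+1) -> (forall n, P (A n)) -> P (\bigcup_n A n)) ->
  forall A, is_borel R A -> P A.
Proof.
move=> PT Pt PC PU Psup A mA.
have gE : is_borel R = <<s (@RGenInftyO.G R) >>.
  exact: RGenInftyO.measurableE.
move: (mA); rewrite [X in X A -> _]gE.
move: A {mA}; apply: dynkin_induction => //.
- move=> _ _ [s ->] [t ->]; exists (Num.min s t).
  apply/seteqP; split=> u /=; rewrite !in_itv /= lt_min.
    by move=> [-> ->].
  by move=> /andP[].
- by move=> _ [t ->]; exact: Pt.
move=> F mF tF hF.
(* The partial unions start with one term: [P] is given for the [F i]. *)
pose U n : set R := \big[setU/set0]_(i < n.+1) F i.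
have mU n : is_borel R (U n).
  by apply: bigsetU_measurable => i _; exact: mF.
have US n : U n.+1 = U n `|` F n.+1 by rewrite /U big_ord_recr.
rewrite -bigcup_bigsetU_bigcup; apply: (Psup U) => // n.
  by rewrite US; exact: subsetUl.
elim: n => [|n IH]; first by rewrite /U big_ord1; exact: hF.
rewrite US; apply: PU => //.
by apply: (@trivIset_bigsetUI _ predT) => // i j _ _; exact: tF.
Qed.

(** Left continuity is stated along the sequence [t - 1/n.+1], which for a
monotone [B] loses nothing and keeps the join countable. *)
Definition resolution (R : realType) (d : Order.disp_t)
    (E : effectAlgebraType d) (B : R -> E) (lo hi : R) : Prop :=
  [/\ forall s t, s <= t -> (B s <= B t)%O,
    forall t, is_sup (fun n => B (t - n.+1%:R^-1)) (B t),
    forall t, t <= lo -> B t = ezero & forall t, hi <= t -> B t = eone].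

Section Determined.
Variables (R : realType) (d : Order.disp_t) (E : sigmaMVEffectAlgebraType d).
Implicit Types (a b : E).

(** A sequence together with its intended join. *)
Definition join_cond : Type := (nat -> E) * E.

Definition valid (c : join_cond) :=
  is_sup c.1 c.2 /\ forall i j, (i <= j)%N -> (c.1 i <= c.1 j)%O.

(** For a valid condition and a state, this says that the value of the join is
the supremum of the values. *)
Definition preserves (w : E -> R) (c : join_cond) :=
  forall eps, 0 < eps -> exists i, w c.2 <= w (c.1 i) + eps.

Lemma separating_state_countable (C : set join_cond) a b :
  countable C -> C `<=` valid -> ~ (a <= b)%O ->
  exists w : E -> R, [/\ is_state w, w b < w a & C `<=` preserves w].
Proof.
move=> /countable_injP[f finj] Cv ab.
pose c0 : join_cond := (fun=> ezero, ezero).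
have c0v : valid c0 by split=> // w; split=> [//|/(_ 0%N)].
pose c n := xget c0 [set x | C x /\ f x = n].
have cv n : valid (c n).
  by rewrite /c; case: xgetP => [x _ [Cx _]|_]; [exact: Cv|].
have [w [hw hab hc]] := separating_state R (fun n => (cv n).1)
  (fun n => (cv n).2) ab.
exists w; split=> // x Cx.
suff <- : c (f x) = x by move=> eps /hc.
rewrite /c; case: xgetP => [y _ [Cy fyx]|/(_ x)[]//].
by apply: finj; rewrite ?inE.
Qed.

Variables (B : R -> E) (lo hi : R).
Hypothesis hB : resolution B lo hi.

Definition left_cond t : join_cond := (fun n => B (t - n.+1%:R^-1), B t).

Lemma left_cond_valid t : valid (left_cond t).
Proof.
have [Bnd Blc _ _] := hB; split=> [|i j ij /=]; first exact: Blc.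
by apply: Bnd; rewrite lerB // lef_pV2 ?posrE ?ltr0n // ler_nat.
Qed.

(** A state need not preserve all the left limits of [B], as there are
uncountably many, so [mu] is tied to [w] only at those [t] where it does. *)
Definition compatible (w : E -> R) (mu : probability (measurableTypeR R) R) :=
  forall t, preserves w (left_cond t) -> mu `]-oo, t[%classic = (w (B t))%:E.

Lemma compatible_exists w : is_state w -> exists mu, compatible w mu.
Proof.
have [Bnd _ Blo Bhi] := hB.
move=> hw; apply: (@left_cdf_measure _ (w \o B) lo hi) => [s t st|t tl|t th] /=.
- exact/(state_le hw)/Bnd.
- by rewrite Blo // (state0 hw).
- by rewrite Bhi // (state1 hw).
Qed.

(** [a] is the value of [A] as seen by all states that preserve a suitable
countable family of joins. Countability of the family is what leaves enough
states to determine [a]. *)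
Definition determined (A : set R) a := exists C : set join_cond,
  [/\ countable C, C `<=` valid
    & forall w mu, is_state w -> C `<=` preserves w -> compatible w mu ->
        mu A = (w a)%:E].

(** If [a] were not below [a'], some state preserving both countable families
would give [a] the larger value, against monotonicity of its measure. *)
Lemma determined_le A A' a a' : is_borel R A -> is_borel R A' -> A `<=` A' ->
  determined A a -> determined A' a' -> (a <= a')%O.
Proof.
move=> mA mA' AA' [C [cC Cv hC]] [C' [cC' Cv' hC']]; apply: contrapT => aa'.
have [|w [hw ww wC]] :=
  separating_state_countable (countable_setU cC cC') _ aa'.
  by move=> c [/Cv|/Cv'].
have [mu hmu] := compatible_exists hw.
have h : (mu A <= mu A')%E by rewrite le_measure ?inE.
have muA : mu A = (w a)%:E by apply: hC => // c Cc; apply: wC; left.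
have muA' : mu A' = (w a')%:E by apply: hC' => // c Cc; apply: wC; right.
by move: h; rewrite muA muA' lee_fin leNgt ww.
Qed.

Lemma determined_uniq A a a' : is_borel R A ->
  determined A a -> determined A a' -> a = a'.
Proof.
by move=> mA h h'; apply/le_anti; rewrite !(determined_le (A := A) (A' := A)).
Qed.

Lemma determined_halfline t : determined `]-oo, t[%classic (B t).
Proof.
exists [set left_cond t]; split; first exact: countable1.
  by move=> _ ->; exact: left_cond_valid.
by move=> w mu hw h; apply; exact: h.
Qed.

Lemma determined_setT : determined setT eone.
Proof.
exists set0; split => // w mu hw _ _.
by rewrite (state1 hw) probability_setT.
Qed.

Lemma determined_setC A a : is_borel R A -> determined A a ->
  determined (~` A) a^⊥.
Proof.
move=> mA [C [cC Cv hC]]; exists C; split=> // w mu hw h1 h2.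
by rewrite probability_setC // (hC w mu) // (state_ortho hw).
Qed.

Lemma determined_setU A A' a a' :
  is_borel R A -> is_borel R A' -> A `&` A' = set0 ->
  determined A a -> determined A' a' ->
  exists2 s, a%:S + a'%:S = s%:S & determined (A `|` A') s.
Proof.
move=> mA mA' AA' hA hA'.
have [s hs] : exists s, a%:S + a'%:S = s%:S.
  apply/addt_defP; apply: determined_le hA (determined_setC mA' hA') => //.
    exact: measurableC.
  by apply/disjoints_subset.
exists s => //; have [C [cC Cv hC]] := hA; have [C' [cC' Cv' hC']] := hA'.
exists (C `|` C'); split.
- exact: countable_setU.
- by move=> c [/Cv|/Cv'].
move=> w mu hw h1 h2.
have muA : mu A = (w a)%:E by apply: hC => // c Cc; apply: h1; left.
have muA' : mu A' = (w a')%:E by apply: hC' => // c Cc; apply: h1; right.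
rewrite measureU // (state_add hw hs) EFinD.
by congr (_ + _)%E; [exact: muA|exact: muA'].
Qed.

(** The one new condition is that the join of the [a n] be preserved; it makes
the value of the join the limit of the measures of the [A n]. *)
Lemma determined_bigcup (A : nat -> set R) (a : nat -> E) :
  (forall n, is_borel R (A n)) -> (forall n, A n `<=` A n.+1) ->
  (forall n, determined (A n) (a n)) ->
  determined (\bigcup_n A n) (countable_join a).
Proof.
move=> mA Ai hA.
have An i j : (i <= j)%N -> A i `<=` A j.
  move=> /subnK <-; elim: (j - i)%N => // k IH; exact: subset_trans IH (Ai _).
have an i j : (i <= j)%N -> (a i <= a j)%O.
  by move=> ij; apply: determined_le (An _ _ ij) (hA i) (hA j).
pose C n := sval (cid (hA n)).
have CP n := svalP (cid (hA n)); rewrite -/(C _) in CP.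
exists ((\bigcup_n C n) `|` [set (a, countable_join a)]); split.
- apply: countable_setU; last exact: countable1.
  by apply: bigcup_countable => // n _; have [] := CP n.
- move=> c [[n _ Cc]|->]; first by have [_ h _] := CP n; exact: h.
  by split=> //; exact: (countable_joinP 0%N).
move=> w mu hw h1 h2.
have muA n : mu (A n) = (w (a n))%:E.
  have [_ _ h] := CP n; apply: h => // c Cc; apply: h1; left.
  by exists n.
apply/le_anti/andP; split; last first.
  apply/lee_addgt0Pr => eps e0.
  have [|i /= hwi] := h1 (a, countable_join a) _ eps e0; first by right.
  apply: (@le_trans _ _ ((w (a i))%:E + eps%:E)%E).
    by rewrite -EFinD lee_fin.
  rewrite leeD2r // -muA le_measure ?inE //; first exact: bigcup_measurable.
  exact: bigcup_sup.
have cv : (mu \o A) @ \oo --> mu (\bigcup_n A n).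
  apply: nondecreasing_cvg_mu => //; first exact: bigcup_measurable.
  by move=> m n mn; apply/subsetPset; exact: An.
apply: (cvge_le _ cv); apply: nearW => n /=.
rewrite [leLHS]muA lee_fin (state_le hw) //.
exact: is_sup_ub (countable_joinP 0%N a).
Qed.

Lemma determined_exists A : is_borel R A -> exists a, determined A a.
Proof.
move: A; apply: borel_induction.
- by exists eone; exact: determined_setT.
- by move=> t; exists (B t); exact: determined_halfline.
- by move=> A mA [a ha]; exists a^⊥; exact: determined_setC.
- move=> A A' mA mA' AA' [a ha] [a' ha'].
  by have [s _ hs] := determined_setU mA mA' AA' ha ha'; exists s.
- move=> A mA Ai hA; exists (countable_join (fun n => sval (cid (hA n)))).
  by apply: determined_bigcup => // n; exact: svalP (cid (hA n)).
Qed.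

End Determined.

(** * Observables and their spectral resolutions *)

Lemma borel_inj (R : realType) : injective (@borel_set R).
Proof.
move=> [A mA] [A' mA'] /= AA'; subst A'.
by congr Borel; exact: Prop_irrelevance.
Qed.

Section ObservableTheory.
Variables (R : realType) (d : Order.disp_t) (E : mvEffectAlgebraType d).
Variables (x : borel R -> E) (hx : observable x).
Implicit Types A B C : borel R.

Lemma observable_setT A : A = setT :> set R -> x A = eone.
Proof. by case: hx => h _ _; exact: h. Qed.

Lemma observable_add A B C : A `&` B = set0 -> C = A `|` B :> set R ->
  (x A)%:S + (x B)%:S = (x C)%:S.
Proof. by case: hx => _ h _; exact: h. Qed.

Lemma observable_sup (A : nat -> borel R) C : (forall i, A i `<=` A i.+1) ->
  C = \bigcup_i A i :> set R -> is_sup (fun i => x (A i)) (x C).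
Proof. by case: hx => _ _ h Ai CA; apply/is_supP; exact: h. Qed.

Lemma observable_le A B : A `<=` B -> (x A <= x B)%O.
Proof.
move=> AB.
have mD : measurable (B `\` A : set (measurableTypeR R)).
  by apply: measurableD; exact: borel_measurable.
apply: (@addt_le _ _ _ (x (Borel mD))%:S); apply: observable_add => /=.
  exact: setDIK.
by rewrite setDUK.
Qed.

Lemma observable_setC A B : B = ~` A :> set R -> x B = (x A)^⊥.
Proof.
move=> BA.
have := @observable_add A B (Borel measurableT).
rewrite BA setICr setUv => /(_ erefl erefl).
rewrite (@observable_setT (Borel measurableT)) //.
by move=> /eortho_uniq/defined_inj.
Qed.

(** The upper end is [b + 1] because the half-line up to [b] leaves out the
point [b] itself. *)
Lemma spectral_resolutionP a b : x (borel_itv `[a, b]) = eone ->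
  resolution (spectral_resolution x) a (b + 1).
Proof.
move=> xab; split.
- move=> s t st; apply: observable_le; apply: subset_itvl.
  by rewrite bnd_simp.
- move=> t.
  apply: (@observable_sup (fun n => borel_itv `]-oo, t - n.+1%:R^-1[)).
    move=> n; apply: subset_itvl; rewrite bnd_simp.
    by rewrite lerB // lef_pV2 ?posrE ?ltr0n // ler_nat.
  rewrite /= halfline_bigcup; apply/seteqP; split=> u [n _ /=].
    rewrite in_itv /= => un; exists n.+1 => //=; rewrite in_itv /=.
    apply: le_lt_trans un _.
    by rewrite ltrD2l ltrN2 ltf_pV2 ?posrE ?ltr0n // ltr_nat.
  by rewrite in_itv /= => un; exists n => //=; rewrite in_itv /= ltW.
- move=> t ta; apply: le_ezero; rewrite -eortho1 -xab.
  have mC : measurable (~` `[a, b]%classic : set (measurableTypeR R)).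
    by apply: measurableC; exact: measurable_itv.
  rewrite -(@observable_setC _ (Borel mC)) //.
  apply: observable_le => /= u; rewrite /= !in_itv /= => ut /andP[au _].
  by have := lt_le_trans ut (le_trans ta au); rewrite ltxx.
- move=> t bt; apply/le_anti; rewrite le_eone -xab /=.
  apply: observable_le => /= u; rewrite /= !in_itv /= => /andP[_ ub].
  by lra.
Qed.

Lemma resolution_bounded lo hi : resolution (spectral_resolution x) lo hi ->
  bounded_observable x.
Proof.
move=> [_ _ Blo Bhi]; split=> //; exists lo, hi.
have mD : measurable (`]-oo, hi[ `\` `]-oo, lo[ : set (measurableTypeR R)).
  by apply: measurableD; exact: measurable_itv.
have mU : measurable (`]-oo, lo[ `|` (`]-oo, hi[ `\` `]-oo, lo[)
    : set (measurableTypeR R)).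
  by apply: measurableU => //; exact: measurable_itv.
have := @observable_add (borel_itv `]-oo, lo[) (Borel mD) (Borel mU).
rewrite -/(spectral_resolution x lo) (Blo lo) // zerotE add0r.
have hU : x (Borel mU) = eone.
  apply/le_anti; rewrite le_eone /= -(Bhi hi) //.
  apply: observable_le => /= u hu.
  by have [|] := pselect (`]-oo, lo[%classic u); [left|right].
rewrite hU => h; apply/le_anti; rewrite le_eone /=.
have <- : x (Borel mD) = eone.
  by apply: defined_inj; apply: h => //=; exact: setDIK.
apply: observable_le => /= u [] /=; rewrite !in_itv /= => uh /negP.
by rewrite -leNgt => ->; rewrite ltW.
Qed.

End ObservableTheory.

(** A function on [borel R] also receives a proof of measurability, hence the
quantification over such proofs in the induction predicate. *)
Lemma observable_ext (R : realType) (d : Order.disp_t)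
    (E : mvEffectAlgebraType d) (z1 z2 : borel R -> E) :
  observable z1 -> observable z2 ->
  (forall t, spectral_resolution z1 t = spectral_resolution z2 t) -> z1 = z2.
Proof.
move=> h1 h2 hs; apply/funext => -[A mA].
pose P (A : set (measurableTypeR R)) :=
  forall mA : measurable A, z1 (Borel mA) = z2 (Borel mA).
suff : P A by exact.
have [U1 _ _] := h1; have [U2 _ _] := h2.
move: A {mA} (mA); apply: borel_induction.
- by move=> mT; rewrite U1 ?U2.
- move=> t mt; rewrite (@borel_inj _ (Borel mt) (borel_itv `]-oo, t[)) //.
  exact: hs.
- move=> A mA PA mC.
  rewrite (observable_setC h1 (A := Borel mA) (B := Borel mC)) // PA.
  exact/esym/observable_setC.
- move=> A A' mA mA' AA' PA PA' mU; apply: defined_inj.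
  rewrite -(observable_add h1 (A := Borel mA) (B := Borel mA')
    (C := Borel mU)) //.
  by rewrite PA PA'; exact: observable_add.
- move=> A mA Ai PA mU.
  apply: (is_sup_uniq (observable_sup h1 (A := fun n => Borel (mA n))
    (C := Borel mU) Ai erefl)).
  have -> : (fun n => z1 (Borel (mA n))) = (fun n => z2 (Borel (mA n))).
    by apply/funext => n; exact: PA.
  exact: observable_sup.
Qed.

(** * The sum of two spectral resolutions *)

Section MinConvolution.
Variables (R : realType) (d : Order.disp_t) (E : sigmaMVEffectAlgebraType d).
Implicit Types (B C : R -> E).

(** The sum of the statement, for arbitrary resolutions: a convolution with
meet and join in place of product and sum. *)
Definition minconv B C t : E :=
  countable_join (fun r : rat => B (ratr r) ⊓ C (t - ratr r)).

Lemma minconvP B C t :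
  is_sup (fun r : rat => B (ratr r) ⊓ C (t - ratr r)) (minconv B C t).
Proof. exact: (countable_joinP (0 : rat)). Qed.

Lemma minconv_nd B C lo hi : resolution C lo hi ->
  forall s t, s <= t -> (minconv B C s <= minconv B C t)%O.
Proof.
move=> [Cnd _ _ _] s t st; apply: (is_sup_least (minconvP B C s)) => r.
apply: le_trans (is_sup_ub r (minconvP B C t)).
by apply: leI2 => //; apply: Cnd; rewrite lerD2r.
Qed.

(** The left limit is taken in [C] alone, inside each meet, by distributivity.
*)
Lemma minconv_left_cont B C lo hi : resolution C lo hi ->
  forall t, is_sup (fun n => minconv B C (t - n.+1%:R^-1)) (minconv B C t).
Proof.
move=> hC t w; split=> [tw n|hw].
  apply: le_trans tw; apply: (minconv_nd B hC).
  by rewrite lerBlDr lerDl invr_ge0 ler0n.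
have [_ Clc _ _] := hC.
apply: (is_sup_least (minconvP B C t)) => r.
apply: (is_sup_least (is_sup_meet _ (Clc _))) => n.
apply: le_trans (hw n); rewrite addrAC.
exact: is_sup_ub r (minconvP B C _).
Qed.

(** By left continuity of [C], [t - r] may be replaced by a rational [q]
slightly smaller, and then [r <= t - q]. *)
Lemma minconv_le_sym B C lo hi lo' hi' t :
  resolution B lo hi -> resolution C lo' hi' ->
  (minconv B C t <= minconv C B t)%O.
Proof.
move=> [Bnd _ _ _] [Cnd Clc _ _].
apply: (is_sup_least (minconvP B C t)) => r.
apply: (is_sup_least (is_sup_meet _ (Clc _))) => n.
have [|q] := @rat_in_itvoo R (t - ratr r - n.+1%:R^-1) (t - ratr r).
  by rewrite ltrBlDr ltrDl invr_gt0 ltr0n.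
rewrite in_itv /= => /andP[q1 q2].
apply: le_trans (is_sup_ub q (minconvP C B t)).
rewrite meetC; apply: leI2; [apply: Cnd; exact: ltW|].
by apply: Bnd; rewrite lerBrDl -lerBrDr ltW.
Qed.

Lemma minconv_lo B C lo hi lo' hi' t :
  resolution B lo hi -> resolution C lo' hi' -> t <= lo + lo' ->
  minconv B C t = ezero.
Proof.
move=> [_ _ Blo _] [_ _ Clo _] ht; apply: le_ezero.
apply: (is_sup_least (minconvP B C t)) => r.
have [rl|rl] := leP (ratr r) lo; first by rewrite Blo // leIl.
by rewrite Clo ?leIr //; lra.
Qed.

Lemma minconv_hi B C lo hi lo' hi' t :
  resolution B lo hi -> resolution C lo' hi' -> hi + hi' + 1 <= t ->
  minconv B C t = eone.
Proof.
move=> [_ _ _ Bhi] [_ _ _ Chi] ht; apply/le_anti; rewrite le_eone /=.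
(* The slack [1] in the upper end leaves room for a rational. *)
have [|q] := @rat_in_itvoo R hi (t - hi'); first by lra.
rewrite in_itv /= => /andP[q1 q2].
apply: le_trans (is_sup_ub q (minconvP B C t)).
by rewrite Bhi ?Chi ?meetxx //; lra.
Qed.

Lemma minconv_resolution B C lo hi lo' hi' :
  resolution B lo hi -> resolution C lo' hi' ->
  resolution (minconv B C) (lo + lo') (hi + hi' + 1).
Proof.
move=> hB hC; split; [exact: minconv_nd hC|exact: minconv_left_cont hC| |] => t.
  exact: minconv_lo hB hC.
exact: minconv_hi hB hC.
Qed.

End MinConvolution.

(** The value of each Borel set is the element determined by it; uniqueness of
that element transports every closure property of [determined] to an axiom of
observables. *)
Lemma observable_of_resolution (R : realType) (d : Order.disp_t)
    (E : sigmaMVEffectAlgebraType d) (B : R -> E) lo hi :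
  resolution B lo hi ->
  exists2 z, observable z & forall t, spectral_resolution z t = B t.
Proof.
move=> hB; have ex (A : borel R) : exists a, determined B A a.
  exact: (determined_exists hB (borel_measurable A)).
pose z A := sval (cid (ex A)).
have zP (A : borel R) : determined B A (z A) by exact: svalP (cid (ex A)).
have uniq (A : borel R) a : determined B A a -> z A = a.
  exact: (determined_uniq hB (borel_measurable A)).
exists z; last by move=> t; apply: uniq; exact: determined_halfline hB t.
split.
- by move=> A AT; apply: uniq; rewrite AT; exact: determined_setT.
- move=> A A' C AA' CE.
  have [s hs ds] := determined_setU hB (borel_measurable A)
    (borel_measurable A') AA' (zP A) (zP A').
  by apply: (etrans hs); congr Some; apply/esym/uniq; rewrite CE.
- move=> A C Ai CE; apply/is_supP.
  suff -> : z C = countable_join (fun i => z (A i)).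
    exact: (countable_joinP 0%N).
  apply: uniq; rewrite CE.
  exact: (determined_bigcup hB (fun n => borel_measurable (A n)) Ai).
Qed.

Theorem theorem3p3 (R : realType) (d : Order.disp_t)
    (E : sigmaMVEffectAlgebraType d) (x y : borel R -> E)
    (hx : bounded_observable x) (hy : bounded_observable y) :
  [/\ (forall t s : R, t < s -> (spectral_sum x y t <= spectral_sum x y s)%O),
      infimums (range (spectral_sum x y)) ezero /\
        supremums (range (spectral_sum x y)) eone,
      (forall s : R,
         supremums [set spectral_sum x y t | t in [set t : R | t < s]]
           (spectral_sum x y s)),
      (exists! z : borel R -> E, bounded_observable z /\
         forall t : R, spectral_sum x y t = spectral_resolution z t)
    & (forall t : R, spectral_sum x y t = spectral_sum y x t)].
Proof.
have sumE (u v : borel R -> E) :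
    spectral_sum u v =
    minconv (spectral_resolution u) (spectral_resolution v) by [].
have [ox [ax [bx /(spectral_resolutionP ox) rx]]] := hx.
have [oy [ay [cy /(spectral_resolutionP oy) ry]]] := hy.
have rS := minconv_resolution rx ry; rewrite -sumE in rS.
move: rS; set lo := ax + ay; set hi := _ + _ + 1 => rS.
have [Snd Slc Slo Shi] := rS.
split.
- by move=> t s ts; apply: Snd; exact: ltW.
- split; split.
  + by move=> _ [t _ <-]; exact: ezero_le.
  + by move=> w hw; apply: hw; exists lo => //; exact: Slo.
  + by move=> _ [t _ <-]; exact: le_eone.
  + by move=> w hw; apply: hw; exists hi => //; exact: Shi.
- move=> s; split; first by move=> _ [t /= ts <-]; apply: Snd; exact: ltW.
  move=> w hw; apply: (is_sup_least (Slc s)) => n; apply: hw.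
  by exists (s - n.+1%:R^-1) => //=; rewrite ltrBlDr ltrDl invr_gt0 ltr0n.
- have [z oz zS] := observable_of_resolution rS; exists z; split.
    split=> //; apply: (resolution_bounded oz (lo := lo) (hi := hi)).
    by rewrite (_ : spectral_resolution z = spectral_sum x y) //; exact/funext.
  move=> z' [[oz' _] zS']; apply: observable_ext => // t.
  by rewrite zS zS'.
- move=> t; rewrite !sumE; apply/le_anti.
  by rewrite (minconv_le_sym t rx ry) (minconv_le_sym t ry rx).
Qed.
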